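(* The Banach algebras $A$ and $B$ defined in the context are both left-primitive.
   Context: $\mathbb{T}$ is the unit circle in $\mathbb{C}$ and $\mathbb{Z}_+=\{k\in\mathbb{Z}:k\ge 0\}$. $S$ is the semigroup with identity generated by $x$ and $y$, subject to $y$ being invertible and $yx=xy^2$, so $S=\{x^my^n: m\in\mathbb{Z}_+,\ n\in\mathbb{Z}\}$ with product $x^my^n\,x^py^q=x^{m+p}y^{n2^p+q}$. $W$ denotes the Wiener algebra of continuous complex functions on $\mathbb{T}$ with absolutely convergent Fourier series; for $\phi\in W$, $\|\phi\|_1$ is the sum of the absolute values of its Fourier coefficients (so $W\cong\ell^1(\mathbb{Z})$). $A=\ell^1(S)$ is regarded as the algebra of formal series $a=\sum_{m=0}^\infty x^m\phi_m$ (also written $\sum x^m\phi_m(y)$) with $\phi_m\in W$ and $\|a\|=\sum_{m}\|\phi_m\|_1<\infty$. $B$ is the algebra of formal series $b=\sum_{m=0}^\infty x^m\phi_m$ with $\phi_m\in C(\mathbb{T})$ and $\|b\|=\sum_m\|\phi_m\|_\infty<\infty$. Here $y$ is identified with the function $\zeta\mapsto\zeta$ on $\mathbb{T}$, and in both algebras the product is determined by $(x^m\phi)(x^n\psi)=x^{m+n}\,\phi(\zeta^{2^n})\psi(\zeta)$, i.e. the coefficient function of $x^{m+n}$ is $\zeta\mapsto\phi(\zeta^{2^n})\psi(\zeta)$. A left module $V$ over an algebra is irreducible if the action is non-zero and $V$ has no submodules other than $(0)$ and $V$ (in the purely algebraic sense). It is faithful if only $0$ annihilates all of $V$. An algebra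 is left-primitive if it has a faithful irreducible left module. *)

(* Defs.v *)
From HB Require Import structures.
From mathcomp Require Import all_boot all_order all_algebra complex.
From mathcomp Require Import all_classical all_reals all_analysis.
From mathcomp Require Import ring lra.

Set Implicit Arguments.
Unset Strict Implicit.
Unset Printing Implicit Defensive.

Import Order.TTheory GRing.Theory Num.Theory.
Import numFieldNormedType.Exports.
Import Normc.
Local Notation Re := complex.Re.
Local Notation Im := complex.Im.

Local Open Scope classical_set_scope.
Local Open Scope ring_scope.
Local Open Scope complex_scope.

(* [R[i]] itself carries no topology in the library: the usual one is that of
   the normed module [R[i]^o], and [circle R] gets the induced topology. *)
Definition circle (R : realType) := set_type [set z : R[i]^o | `|z| = 1].

HB.instance Definition _ (R : realType) := Topological.on (circle R).

Definition circle_val (R : realType) (z : circle R) : R[i] := \val z.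

Lemma circle_valP (R : realType) (z : circle R) : `|circle_val z| = 1.
Proof. exact: (set_mem (valP z)). Qed.

Definition mk_circle (R : realType) (z : R[i]) (z1 : `|z| = 1) : circle R :=
  exist _ z (mem_set z1).

Lemma circle_exp_subproof (R : realType) (z : circle R) (n : nat) :
  `|circle_val z ^+ n| = 1.
Proof. by rewrite normrX circle_valP expr1n. Qed.

Definition circle_exp (R : realType) (z : circle R) (n : nat) : circle R :=
  mk_circle (circle_exp_subproof z n).

Lemma cis_subproof (R : realType) (t : R) : `|cos t +i* sin t| = 1 :> R[i].
Proof. by rewrite normc_def /= cos2Dsin2 sqrtr1. Qed.

Definition cis (R : realType) (t : R) : circle R := mk_circle (cis_subproof t).

Definition circle_mean (R : realType) (f : circle R -> R[i]) : R[i] :=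
  ((pi *+ 2)^-1 *
    \int[@lebesgue_measure R]_(t in `[0, pi *+ 2]) Re (f (cis t))) +i*
  ((pi *+ 2)^-1 *
    \int[@lebesgue_measure R]_(t in `[0, pi *+ 2]) Im (f (cis t))).

(* The Fourier coefficient (2 pi)^-1 int_0^(2 pi) f(e^(it)) e^(-int) dt. *)
Definition fourier (R : realType) (f : circle R -> R[i]) (n : int) : R[i] :=
  circle_mean (fun z => f z * circle_val z ^ (- n)).

Definition normw (R : realType) (f : circle R -> R[i]) : \bar R :=
  \esum_(n in [set: int]) (normc (fourier f n))%:E.

Definition normu (R : realType) (f : circle R -> R[i]) : \bar R :=
  ereal_sup [set (normc (f z))%:E | z in [set: circle R]].

Definition wiener (R : realType) (f : circle R -> R[i]) : Prop :=
  continuous (f : circle R -> R[i]^o) /\ (normw f < +oo)%E.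

(* [a : fseries R] stands for the formal series of the [x^m (a m)]; the
   coefficients are arbitrary functions on the circle until they are restricted
   in [in_A] and [in_B]. *)
Definition fseries (R : realType) : Type := nat -> circle R -> R[i].

HB.instance Definition _ (R : realType) :=
  GRing.Lmodule.copy (fseries R) (nat -> circle R -> R[i]).

Definition fs_one (R : realType) : fseries R := fun m _ => (m == 0%N)%:R.

(* The coefficient of [x^k] collects the products
   [(x^i a_i) (x^(k-i) b_(k-i)) = x^k a_i(z^(2^(k-i))) b_(k-i)(z)]. *)
Definition fs_mul (R : realType) (a b : fseries R) : fseries R := fun k z =>
  \sum_(i < k.+1) a i (circle_exp z (2 ^ (k - i))) * b (k - i)%N z.

Definition normA (R : realType) (a : fseries R) : \bar R :=
  \sum_(0 <= m <oo) normw (a m).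

Definition normB (R : realType) (b : fseries R) : \bar R :=
  \sum_(0 <= m <oo) normu (b m).

(* [l^1(S)] for the monoid [S] generated by [x], [y], [y^-1] with
   [y x = x y^2]: the element [x^m y^n] is the series whose only coefficient is
   the function [z^n], in degree [m]. *)
Definition in_A (R : realType) : {pred fseries R} := fun a =>
  `[< (forall m, wiener (a m)) /\ (normA a < +oo)%E >].

Definition in_B (R : realType) : {pred fseries R} := fun b =>
  `[< (forall m, continuous (b m : circle R -> R[i]^o)) /\
      (normB b < +oo)%E >].

(* For a unital algebra [A] over a field [k], a module over the ring [A] is a
   vector space through [c%:A], so that its [A]-submodules are subspaces; a
   not necessarily unital module that is irreducible is automatically unital. *)
Definition irreducible_module (A : pzRingType) (V : lmodType A) : Prop :=
  (exists (a : A) (v : V), a *: v <> 0) /\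
  (forall U : {pred V}, GRing.submod_closed U ->
    U =i pred1 (0 : V) \/ U =i predT).

Definition faithful_module (A : pzRingType) (V : lmodType A) : Prop :=
  forall a : A, (forall v : V, a *: v = 0) -> a = 0.

Definition left_primitive (A : pzRingType) : Prop :=
  exists V : lmodType A, irreducible_module V /\ faithful_module V.

Lemma circle_val_inj (R : realType) : injective (@circle_val R).
Proof. exact: val_inj. Qed.

Lemma mk_circleE (R : realType) (z : R[i]) (z1 : `|z| = 1) :
  circle_val (mk_circle z1) = z.
Proof. by []. Qed.

Lemma circle_expE (R : realType) (z : circle R) n :
  circle_val (circle_exp z n) = circle_val z ^+ n.
Proof. by []. Qed.

Lemma circle_exp1 (R : realType) (z : circle R) : circle_exp z 1 = z.
Proof. exact: circle_val_inj. Qed.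

Lemma circle_expM (R : realType) (z : circle R) m n :
  circle_exp (circle_exp z m) n = circle_exp z (m * n).
Proof. by apply: circle_val_inj; rewrite !circle_expE exprM. Qed.

Section FormalSeries.
Variable R : realType.
Implicit Types a b c : fseries R.

Lemma fs_addE a b k z : (a + b) k z = a k z + b k z. Proof. by []. Qed.
Lemma fs_scaleE (t : R[i]) a k z : (t *: a) k z = t * a k z. Proof. by []. Qed.

Lemma fs_mulA : associative (@fs_mul R).
Proof.
move=> a b c; apply/funext => k; apply/funext => z; rewrite /fs_mul.
pose F i j := a i (circle_exp z (2 ^ (k - i))) *
  (b (j - i)%N (circle_exp z (2 ^ (k - j))) * c (k - j)%N z).
transitivity (\sum_(i < k.+1) \sum_(j < k.+1 | (i <= j)%N) F i j).
  apply: eq_bigr => -[i /= ik] _; rewrite mulr_sumr.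
  rewrite ltnS in ik.
  rewrite -(big_mkord (fun j => i <= j)%N (fun j => F i j)).
  rewrite -(big_mkord xpredT (fun j => a i (circle_exp z (2 ^ (k - i))) *
    (b j (circle_exp z (2 ^ (k - i - j))) * c (k - i - j)%N z))).
  rewrite [RHS](@big_cat_nat _ _ _ i) //=; last exact: leqW.
  have -> : \sum_(0 <= j < i | (i <= j)%N) F i j = 0.
    rewrite big_nat_cond big_pred0//.
    by move=> j; apply/negP => /andP[/andP[_ ji]]; rewrite leqNgt ji.
  have -> : \sum_(i <= j < k.+1 | (i <= j)%N) F i j =
      \sum_(0 <= j < k.+1 - i) F i (j + i)%N.
    by rewrite -{1}(add0n i) big_addn; apply: eq_bigl => j; rewrite leq_addl.
  rewrite add0r subSn//; apply: eq_bigr => j _.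
  by rewrite /F addnK addnC subnDA.
rewrite (exchange_big_dep predT) //=; apply: eq_bigr => -[j /= jk] _.
rewrite ltnS in jk.
rewrite mulr_suml.
rewrite -(big_mkord (fun i => i <= j)%N (fun i => F i j)).
rewrite -(big_mkord xpredT (fun i => a i (circle_exp (circle_exp z (2 ^ (k - j)))
   (2 ^ (j - i))) * b (j - i)%N (circle_exp z (2 ^ (k - j))) * c (k - j)%N z)).
rewrite (@big_cat_nat _ _ _ j.+1) //=.
have -> : \sum_(j.+1 <= i < k.+1 | (i <= j)%N) F i j = 0.
  rewrite big_nat_cond big_pred0//.
  by move=> i; apply/negP => /andP[/andP[ji _]]; rewrite leqNgt ji.
rewrite addr0 big_nat_cond [RHS]big_nat_cond; apply: eq_big => [i|i].
  by rewrite ltnS; case: (i <= j)%N.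
rewrite ltnS => /andP[_ ij]; rewrite /F mulrA circle_expM -expnD.
by rewrite addnBA// subnK.
Qed.

Lemma fs_mul1r : left_id (@fs_one R) (@fs_mul R).
Proof.
move=> a; apply/funext => k; apply/funext => z; rewrite /fs_mul /fs_one.
rewrite big_ord_recl big1/=; first by rewrite addr0 subn0 mul1r.
by move=> i _; rewrite mul0r.
Qed.

Lemma fs_mulr1 : right_id (@fs_one R) (@fs_mul R).
Proof.
move=> a; apply/funext => k; apply/funext => z; rewrite /fs_mul /fs_one.
rewrite big_ord_recr big1/=; first by rewrite add0r subnn expn0 circle_exp1 mulr1.
by move=> i _; rewrite subn_eq0 leqNgt ltn_ord mulr0.
Qed.

Lemma fs_mulDl : left_distributive (@fs_mul R) +%R.
Proof.
move=> a b c; apply/funext => k; apply/funext => z.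
rewrite fs_addE /fs_mul -big_split; apply: eq_bigr => i _.
exact: mulrDl.
Qed.

Lemma fs_mulDr : right_distributive (@fs_mul R) +%R.
Proof.
move=> a b c; apply/funext => k; apply/funext => z.
rewrite fs_addE /fs_mul -big_split; apply: eq_bigr => i _.
exact: mulrDr.
Qed.

Lemma fs_one_neq0 : @fs_one R != 0.
Proof.
apply/eqP => /(congr1 (fun f : fseries R => f 0%N (cis 0))).
by rewrite /fs_one/= => /eqP; rewrite oner_eq0.
Qed.

HB.instance Definition _ := GRing.Zmodule_isNzRing.Build (fseries R)
  fs_mulA fs_mul1r fs_mulr1 fs_mulDl fs_mulDr fs_one_neq0.

Lemma fs_scalerAl (t : R[i]) a b : t *: (a * b) = (t *: a) * b.
Proof.
apply/funext => k; apply/funext => z; rewrite fs_scaleE mulr_sumr.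
by apply: eq_bigr => i _; rewrite mulrA.
Qed.

Lemma fs_scalerAr (t : R[i]) a b : t *: (a * b) = a * (t *: b).
Proof.
apply/funext => k; apply/funext => z; rewrite fs_scaleE mulr_sumr.
by apply: eq_bigr => i _; rewrite mulrCA.
Qed.

HB.instance Definition _ :=
  GRing.Lmodule_isLalgebra.Build R[i] (fseries R) fs_scalerAl.
HB.instance Definition _ :=
  GRing.Lalgebra_isAlgebra.Build R[i] (fseries R) fs_scalerAr.

Lemma fs_mulE a b k z : (a * b) k z =
  \sum_(i < k.+1) a i (circle_exp z (2 ^ (k - i))) * b (k - i)%N z.
Proof. by []. Qed.

End FormalSeries.

Definition fs_monomial (R : realType) m (f : circle R -> R[i]) : fseries R :=
  fun k z => if k == m then f z else 0.

Lemma fs_monomialM (R : realType) m n (f g : circle R -> R[i]) :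
  fs_monomial m f * fs_monomial n g =
  fs_monomial (m + n) (fun z => f (circle_exp z (2 ^ n)) * g z).
Proof.
apply/funext => k; apply/funext => z; rewrite fs_mulE /fs_monomial.
have [->|kmn] := eqVneq k (m + n)%N.
  have mk : (m < (m + n).+1)%N by rewrite ltnS leq_addr.
  rewrite (bigD1 (Ordinal mk)) //= eqxx addKn eqxx big1 ?addr0// => i im.
  by rewrite ifN ?mul0r//; apply: contraNneq im => im; apply/eqP/val_inj.
rewrite big1// => -[i /= ik] _; have [im|] := eqVneq i m; last by rewrite mul0r.
rewrite ifN ?mulr0//; apply: contraNneq kmn => kin.
by rewrite -im -kin subnKC.
Qed.

Lemma nneseries_le (R : realType) (u : nat -> \bar R) (x : \bar R) :
  (forall i, (0 <= u i)%E) ->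
  (forall n, (\sum_(i < n) u i <= x)%E) -> (\sum_(0 <= i <oo) u i <= x)%E.
Proof.
move=> u0 ux; apply: lime_le; first exact: is_cvg_nneseries.
by apply: nearW => n; rewrite big_mkord.
Qed.

Lemma nneseries_ge (R : realType) (u : nat -> \bar R) n :
  (forall i, (0 <= u i)%E) ->
  (\sum_(i < n) u i <= \sum_(0 <= i <oo) u i)%E.
Proof.
by move=> u0; rewrite -(big_mkord xpredT u); apply: nneseries_lim_ge.
Qed.

Lemma nneseries_cauchy (R : realType) (u v : nat -> \bar R) :
  (forall i, (0 <= u i)%E) -> (forall i, (0 <= v i)%E) ->
  (\sum_(0 <= k <oo) (\sum_(i < k.+1) u i * v (k - i)%N) <=
   (\sum_(0 <= i <oo) u i) * (\sum_(0 <= i <oo) v i))%E.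
Proof.
move=> u0 v0; have uv0 i j : (0 <= u i * v j)%E by exact: mule_ge0.
apply: nneseries_le => [k|n]; first exact: sume_ge0.
apply: (@le_trans _ _ ((\sum_(i < n) u i) * (\sum_(i < n) v i))%E); last first.
  by apply: lee_pmul; rewrite ?sume_ge0 ?nneseries_ge.
rewrite ge0_sume_distrl//.
under [leRHS]eq_bigr do rewrite ge0_sume_distrr//.
have -> : (\sum_(k < n) \sum_(i < k.+1) u i * v (k - i)%N =
    \sum_(k < n) \sum_(i < n | (i <= k)%N) u i * v (k - i)%N)%E.
  apply: eq_bigr => -[k /= kn] _.
  rewrite -(big_mkord (fun i => i <= k)%N (fun i => u i * v (k - i)%N)%E).
  rewrite -(big_mkord xpredT (fun i => u i * v (k - i)%N)%E).
  rewrite (@big_cat_nat _ _ _ k.+1 0 n) //=.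
  have -> : (\sum_(k.+1 <= i < n | (i <= k)%N) u i * v (k - i)%N = 0)%E.
    rewrite big_nat_cond big_pred0//.
    by move=> i; apply/negP => /andP[/andP[ji _]]; rewrite leqNgt ji.
  rewrite adde0 big_nat_cond [RHS]big_nat_cond; apply: eq_bigl => i.
  by rewrite ltnS; case: (i <= k)%N.
rewrite (exchange_big_dep predT) //=; apply: lee_sum => -[i /= ni] _.
rewrite -(big_mkord (fun k => i <= k)%N (fun k => u i * v (k - i)%N)%E).
rewrite -(big_mkord xpredT (fun j => u i * v j)%E).
rewrite (@big_cat_nat _ _ _ i 0 n) //=; last exact: ltnW.
have -> : (\sum_(0 <= k < i | (i <= k)%N) u i * v (k - i)%N = 0)%E.
  rewrite big_nat_cond big_pred0//.
  by move=> k; apply/negP => /andP[/andP[_ ji]]; rewrite leqNgt ji.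
rewrite add0e.
have -> : (\sum_(i <= k < n | (i <= k)%N) u i * v (k - i)%N =
    \sum_(0 <= j < n - i) u i * v j)%E.
  rewrite -{1}(add0n i) big_addn; apply: eq_big => j; first by rewrite leq_addl.
  by rewrite addnK.
rewrite [leRHS](@big_cat_nat _ _ _ (n - i)) //=; last exact: leq_subr.
by rewrite leeDl// sume_ge0.
Qed.

Section Generic.
Variable R : realType.
Local Notation X := (circle R -> R[i]).
Variables (P : X -> Prop) (N : X -> \bar R).

Hypothesis P1 : P (fun=> 1).
Hypothesis PD : forall f g, P f -> P g -> P (fun z => f z + g z).
Hypothesis PM : forall f g, P f -> P g -> P (fun z => f z * g z).
Hypothesis PZ : forall t f, P f -> P (fun z => t * f z).
Hypothesis Pexp : forall n f, (0 < n)%N -> P f -> P (fun z => f (circle_exp z n)).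
Hypothesis N_ge0 : forall f, (0 <= N f)%E.
Hypothesis N0 : N (fun=> 0) = 0%E.
Hypothesis N1 : (N (fun=> 1%R) < +oo)%E.
Hypothesis ND : forall f g, P f -> P g -> (N (fun z => f z + g z)%R <= N f + N g)%E.
Hypothesis NM : forall f g, P f -> P g -> (N (fun z => f z * g z)%R <= N f * N g)%E.
Hypothesis NZ : forall t f, P f -> (N (fun z => t * f z)%R <= (normc t)%:E * N f)%E.
Hypothesis Nexp : forall n f, (0 < n)%N -> P f ->
  (N (fun z => f (circle_exp z n)) <= N f)%E.

Definition gen_pred : {pred fseries R} := fun a =>
  `[< (forall m, P (a m)) /\ (\sum_(0 <= m <oo) N (a m) < +oo)%E >].

Let P0 : P (fun=> 0).
Proof. by have := PZ 0 P1; congr P; apply/funext => z; rewrite mul0r. Qed.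

Let Psum n (F : 'I_n -> X) : (forall i, P (F i)) ->
  P (fun z => \sum_(i < n) F i z).
Proof.
elim: n F => [|n IH] F PF.
  by have := P0; congr P; apply/funext => z; rewrite big_ord0.
have := PD (IH (fun i => F (widen_ord (leqnSn n) i)) (fun i => PF _)) (PF ord_max).
by congr P; apply/funext => z; rewrite big_ord_recr.
Qed.

Let Nsum n (F : 'I_n -> X) : (forall i, P (F i)) ->
  (N (fun z => \sum_(i < n) F i z)%R <= \sum_(i < n) N (F i))%E.
Proof.
elim: n F => [|n IH] F PF.
  rewrite big_ord0 -N0 le_eqVlt; apply/orP; left; apply/eqP.
  by congr N; apply/funext => z; rewrite big_ord0.
rewrite big_ord_recr/=.
have PF' (i : 'I_n) : P (F (widen_ord (leqnSn n) i)) by exact: PF.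
apply: le_trans (leeD (IH _ PF') (lexx _)).
apply: le_trans (ND (Psum PF') (PF ord_max)).
rewrite le_eqVlt; apply/orP; left; apply/eqP; congr N.
by apply/funext => z; rewrite big_ord_recr.
Qed.

Lemma gen_subalg_closed : GRing.subalg_closed gen_pred.
Proof.
have N_ser (a : fseries R) : (0 <= \sum_(0 <= m <oo) N (a m))%E.
  by apply: nneseries_ge0 => *; exact: N_ge0.
split.
- apply/asboolP; split.
    case=> [|m]; first exact: P1.
    exact: P0.
  apply: le_lt_trans N1; apply: nneseries_le => [i|n]; first exact: N_ge0.
  case: n => [|n]; first by rewrite big_ord0; exact: N_ge0.
  by rewrite big_ord_recl big1 ?adde0// => i _; exact: N0.
- move=> t a b /asboolP[Pa Na] /asboolP[Pb Nb]; apply/asboolP; split.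
    by move=> m; exact: (PD (PZ t (Pa m)) (Pb m)).
  apply: (@le_lt_trans _ _ (\sum_(0 <= m <oo) ((normc t)%:E * N (a m) + N (b m)))%E).
    apply: lee_nneseries => [m _ _|m _]; first exact: N_ge0.
    apply: le_trans (ND (PZ t (Pa m)) (Pb m)) _.
    by rewrite leeD2r// NZ.
  have t0 : 0 <= normc t by case: (t) => x y; exact: sqrtr_ge0.
  rewrite nneseriesD//; last by move=> i _ _; rewrite mule_ge0.
  rewrite nneseriesZl// lte_add_pinfty//.
  by rewrite lte_mul_pinfty.
- move=> a b /asboolP[Pa Na] /asboolP[Pb Nb]; apply/asboolP.
  have Pab k i : P (fun z => a i (circle_exp z (2 ^ (k - i))) * b (k - i)%N z).
    by apply: PM => //; apply: Pexp => //; rewrite expn_gt0.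
  split; first by move=> k; exact: (Psum (fun i : 'I_k.+1 => Pab k i)).
  apply: (@le_lt_trans _ _ (\sum_(0 <= k <oo)
      (\sum_(i < k.+1) N (a i) * N (b (k - i)%N)))%E).
    apply: lee_nneseries => [m _ _|k _]; first exact: N_ge0.
    apply: le_trans (Nsum (fun i : 'I_k.+1 => Pab k i)) _.
    apply: lee_sum => i _.
    have e0 : (0 < 2 ^ (k - i))%N by rewrite expn_gt0.
    apply: le_trans (NM (Pexp e0 (Pa i)) (Pb _)) _.
    by apply: lee_pmul => //; exact: Nexp.
  apply: (le_lt_trans (@nneseries_cauchy _ (fun i => N (a i)) (fun i => N (b i)) _ _)) => //.
  by rewrite lte_mul_pinfty// ge0_fin_numE.
Qed.

End Generic.

Section NormC.
Variable R : realType.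
Implicit Types (x y : R[i]).

Lemma normc_ge0 x : 0 <= normc x.
Proof. by case: x => a b; exact: sqrtr_ge0. Qed.

Lemma normcB x y : normc (x - y) = normc (y - x).
Proof. by rewrite -normcN opprB. Qed.

Lemma normc_circle (z : circle R) : normc (circle_val z) = 1.
Proof. by have /(congr1 (@complex.Re R)) := circle_valP z. Qed.

Lemma normcX x n : normc (x ^+ n) = normc x ^+ n.
Proof. by elim: n => [|n IH]; rewrite ?expr0 ?normc1// !exprS normcM IH. Qed.

Lemma normc_Re x : `|Re x| <= normc x.
Proof. by rewrite -lecR; exact: normc_ge_Re. Qed.

Lemma normc_Im x : `|Im x| <= normc x.
Proof.
case: x => a b /=; rewrite -sqrtr_sqr; apply: ler_wsqrtr.
by rewrite lerDr sqr_ge0.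
Qed.

Lemma normc_le x : normc x <= `|Re x| + `|Im x|.
Proof.
case: x => a b /=; rewrite -[leRHS]ger0_norm ?addr_ge0// -sqrtr_sqr.
apply: ler_wsqrtr; rewrite sqrrD !real_normK ?num_real//.
by rewrite addrAC lerDl mulrn_wge0// mulr_ge0.
Qed.

Lemma normc_real (t : R) : normc t%:C = `|t|.
Proof. by rewrite /= expr0n/= addr0 sqrtr_sqr. Qed.

Lemma normc_sum (I : Type) (s : seq I) (F : I -> R[i]) :
  normc (\sum_(i <- s) F i) <= \sum_(i <- s) normc (F i).
Proof.
elim: s => [|i s IH]; first by rewrite !big_nil normc0.
by rewrite !big_cons (le_trans (le_normcD _ _))// lerD2l.
Qed.

End NormC.

Section Topology.
Variable R : realType.
Implicit Types (z w : circle R) (f g : circle R -> R[i]).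

Lemma nbhs_circleP z (A : set (circle R)) : nbhs z A <->
  exists2 d : R, 0 < d &
    forall w, normc (circle_val z - circle_val w) < d -> A w.
Proof.
split.
  rewrite nbhsE => -[_ [[V oV <-] Vz] VA].
  have /nbhs_ballP[e /= e0 eV] : nbhs (circle_val z : R[i]^o) V.
    by apply: open_nbhs_nbhs; split.
  have eR : e = (Re e)%:C by rewrite RRe_real// gtr0_real.
  exists (Re e); first by rewrite -ltcR -eR.
  move=> w zw; apply: VA => /=; apply: eV; rewrite /ball/=.
  by rewrite eR ltcR.
move=> [d d0 dA].
rewrite nbhsE; pose V := (ball (circle_val z : R[i]^o) d%:C)^°.
exists (@circle_val R @^-1` V); last first.
  by move=> w /interior_subset; rewrite /ball/= ltcR; exact: dA.
split; first by exists V => //; exact: open_interior.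
by apply: nbhsx_ballx; rewrite ltcR.
Qed.

Lemma nbhs_ccP (x : R[i]^o) (A : set R[i]^o) : nbhs x A <->
  exists2 d : R, 0 < d & forall y, normc (x - y) < d -> A y.
Proof.
split.
  move=> /nbhs_ballP[e /= e0 eV].
  have eR : e = (Re e)%:C by rewrite RRe_real// gtr0_real.
  exists (Re e); first by rewrite -ltcR -eR.
  by move=> w zw; apply: eV; rewrite /ball/= eR ltcR.
move=> [d d0 dA]; apply/nbhs_ballP; exists d%:C; rewrite /= ?ltcR//.
by move=> y /=; rewrite /ball/= ltcR; exact: dA.
Qed.

Lemma circle_continuousP f : continuous (f : circle R -> R[i]^o) <->
  forall z (e : R), 0 < e -> exists2 d : R, 0 < d &
    forall w, normc (circle_val z - circle_val w) < d -> normc (f z - f w) < e.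
Proof.
split=> [cf z e e0|H z].
  have /cf : nbhs (f z : R[i]^o) [set y | normc (f z - y) < e].
    by apply/nbhs_ccP; exists e.
  by move=> /nbhs_circleP.
move=> A /nbhs_ccP[e e0 eA]; have [d d0 dA] := H z e e0.
by apply/nbhs_circleP; exists d => // w zw /=; apply: eA; exact: dA.
Qed.

Lemma ccont_cst (t : R[i]) : continuous ((fun=> t) : circle R -> R[i]^o).
Proof. exact: cst_continuous. Qed.

Lemma ccontD f g : continuous (f : circle R -> R[i]^o) ->
  continuous (g : circle R -> R[i]^o) ->
  continuous ((fun z => f z + g z) : circle R -> R[i]^o).
Proof. move=> cf cg z.
exact: (@cvgD _ R[i]^o _ (nbhs z) _ f g (f z) (g z) (cf z) (cg z)). Qed.

Lemma ccontM f g : continuous (f : circle R -> R[i]^o) ->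
  continuous (g : circle R -> R[i]^o) ->
  continuous ((fun z => f z * g z) : circle R -> R[i]^o).
Proof.
move=> cf cg z.
exact: (@cvgZ _ R[i]^o _ (nbhs z) _ f g (f z) (g z) (cf z) (cg z)).
Qed.

Lemma ccontZ (t : R[i]) f : continuous (f : circle R -> R[i]^o) ->
  continuous ((fun z => t * f z) : circle R -> R[i]^o).
Proof. by move=> cf; apply: ccontM cf; exact: ccont_cst. Qed.

Lemma ccont_sum (I : Type) (s : seq I) (F : I -> circle R -> R[i]) :
  (forall i, continuous (F i : circle R -> R[i]^o)) ->
  continuous ((fun z => \sum_(i <- s) F i z) : circle R -> R[i]^o).
Proof.
move=> cF; elim: s => [|i s IH].
  have -> : (fun z => \sum_(i <- [::]) F i z) = (fun=> 0).
    by apply/funext => z; rewrite big_nil.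
  exact: ccont_cst.
have -> : (fun z => \sum_(j <- i :: s) F j z) =
    (fun z => F i z + \sum_(j <- s) F j z).
  by apply/funext => z; rewrite big_cons.
exact: (ccontD (cF i) IH).
Qed.

Lemma ccont_val : continuous (@circle_val R : circle R -> R[i]^o).
Proof. by apply/circle_continuousP => z e e0; exists e. Qed.

Lemma ccont_valX n :
  continuous ((fun z => circle_val z ^+ n) : circle R -> R[i]^o).
Proof.
elim: n => [|n IH]; first exact: ccont_cst.
have -> : (fun z => circle_val z ^+ n.+1) =
    (fun z => circle_val z * circle_val z ^+ n).
  by apply/funext => z; rewrite exprS.
exact: ccontM ccont_val IH.
Qed.

Lemma ccont_exp n f : continuous (f : circle R -> R[i]^o) ->
  continuous ((fun z => f (circle_exp z n)) : circle R -> R[i]^o).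
Proof.
move=> /circle_continuousP cf; apply/circle_continuousP => z e e0.
have [d d0 fd] := cf (circle_exp z n) e e0.
have [d' d'0 fd'] := (circle_continuousP _).1 (@ccont_valX n) z d d0.
by exists d' => // w zw; apply: fd; exact: fd'.
Qed.

Lemma normu_ub f z : ((normc (f z))%:E <= normu f)%E.
Proof. by apply: ereal_sup_ubound; exists z. Qed.

Lemma normu_le f (x : \bar R) :
  (forall z, ((normc (f z))%:E <= x)%E) -> (normu f <= x)%E.
Proof. by move=> H; apply: ge_ereal_sup => _ [z _ <-]. Qed.

Lemma normu_ge0 f : (0 <= normu f)%E.
Proof. by apply: le_trans (normu_ub f (cis 0)); rewrite lee_fin normc_ge0. Qed.

Lemma in_B_subalg : GRing.subalg_closed (@in_B R).
Proof.
apply: (@gen_subalg_closed R (fun f => continuous (f : circle R -> R[i]^o)) (@normu R)).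
- exact: ccont_cst.
- exact: ccontD.
- exact: ccontM.
- exact: ccontZ.
- by move=> n f _; exact: ccont_exp.
- exact: normu_ge0.
- apply/eqP; rewrite eq_le normu_ge0 andbT; apply: normu_le => z.
  by rewrite normc0.
- apply: (@le_lt_trans _ _ 1%E); last exact: ltry.
  by apply: normu_le => z; rewrite normc1.
- move=> f g _ _; apply: normu_le => z.
  apply: le_trans (leeD (normu_ub f z) (normu_ub g z)).
  by rewrite -EFinD lee_fin le_normcD.
- move=> f g _ _; apply: normu_le => z.
  rewrite normcM EFinM.
  by apply: lee_pmul; rewrite ?lee_fin ?normc_ge0 ?normu_ub.
- move=> t f _; apply: normu_le => z.
  by rewrite normcM EFinM lee_pmul ?lee_fin ?normc_ge0 ?normu_ub.
- by move=> n f _ _; apply: normu_le => z; exact: normu_ub.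
Qed.

End Topology.

Section Mean.
Variable R : realType.
Implicit Types (z w : circle R) (f g : circle R -> R[i]).
Local Notation mu := (@lebesgue_measure R).
Local Notation ccont f := (continuous (f : circle R -> R[i]^o)).

Lemma cis_continuous : continuous (@cis R).
Proof.
move=> t A /nbhs_circleP[d d0 dA].
have d20 : 0 < d / 2 by rewrite divr_gt0.
have Hc : \forall s \near t, `|cos t - cos s| < d / 2.
  by move: (@continuous_cos R t) => /cvgrPdist_lt; exact.
have Hs : \forall s \near t, `|sin t - sin s| < d / 2.
  by move: (@continuous_sin R t) => /cvgrPdist_lt; exact.
near=> s; apply: dA.
apply: le_lt_trans (normc_le _) _; rewrite /= (splitr d) ltrD//.
  by near: s.
by near: s.
Unshelve. all: by end_near. Qed.

Lemma Re_continuous : continuous (@complex.Re R : R[i]^o -> R).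
Proof.
move=> x A /nbhs_ballP[e /= e0 eA]; apply/nbhs_ccP; exists e => // y xy /=.
apply: eA; rewrite /ball/=.
apply: le_lt_trans xy; apply: le_trans (normc_Re _).
by case: (x) => ? ?; case: (y) => ? ? /=.
Qed.

Lemma Im_continuous : continuous (@complex.Im R : R[i]^o -> R).
Proof.
move=> x A /nbhs_ballP[e /= e0 eA]; apply/nbhs_ccP; exists e => // y xy /=.
apply: eA; rewrite /ball/=.
apply: le_lt_trans xy; apply: le_trans (normc_Im _).
by case: (x) => ? ?; case: (y) => ? ? /=.
Qed.

Lemma Re_cis_continuous f : ccont f -> continuous (fun t => Re (f (cis t))).
Proof.
move=> cf t; apply: (@continuous_comp _ _ _ (@cis R) (@complex.Re R \o f)).
  exact: cis_continuous.
apply: (@continuous_comp _ _ _ (f : circle R -> R[i]^o) (@complex.Re R : R[i]^o -> R)).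
  exact: cf.
exact: Re_continuous.
Qed.

Lemma Im_cis_continuous f : ccont f -> continuous (fun t => Im (f (cis t))).
Proof.
move=> cf t; apply: (@continuous_comp _ _ _ (@cis R) (@complex.Im R \o f)).
  exact: cis_continuous.
apply: (@continuous_comp _ _ _ (f : circle R -> R[i]^o) (@complex.Im R : R[i]^o -> R)).
  exact: cf.
exact: Im_continuous.
Qed.

Lemma continuous_integrable (h : R -> R) a b : continuous h ->
  mu.-integrable `[a, b] (EFin \o h).
Proof.
move=> ch; apply: continuous_compact_integrable; first exact: segment_compact.
exact: continuous_subspaceT.
Qed.

Lemma cis_surj z : exists2 t : R, t \in `[- pi, pi] & cis t = z.
Proof.
have nz := normc_circle z.
case E : (circle_val z) nz => [a b] /= ab1.
have {}ab1 : a ^+ 2 + b ^+ 2 = 1.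
  by rewrite -[LHS]sqr_sqrtr ?addr_ge0 ?sqr_ge0// ab1 expr1n.
have a11 : -1 <= a <= 1.
  by rewrite -ler_norml -(@expr_le1 _ 2)// real_normK ?num_real// -ab1 lerDl sqr_ge0.
have sa : sin (acos a) = `|b|.
  by rewrite sin_acos// -ab1 addrC addKr sqrtr_sqr.
have ca : cos (acos a) = a by rewrite acosK// in_itv.
have p0 := acos_ge0 a11; have pp := acos_lepi a11.
have [b0|b0] := leP 0 b.
  exists (acos a).
    by rewrite in_itv/= pp andbT (le_trans _ p0)// oppr_le0 pi_ge0.
  by apply: circle_val_inj; rewrite E /= /cis mk_circleE ca sa ger0_norm.
exists (- acos a).
  by rewrite in_itv/= lerNr opprK pp (le_trans _ (pi_ge0 R))// oppr_le0.
apply: circle_val_inj; rewrite E /= /cis mk_circleE cosN sinN ca sa.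
by rewrite ltr0_norm// opprK.
Qed.

Lemma circle_compact : compact [set: circle R].
Proof.
have -> : [set: circle R] = (@cis R) @` `[- pi, pi].
  by apply/seteqP; split => // z _; have [t tpi <-] := cis_surj z; exists t.
apply: continuous_compact; last exact: segment_compact.
exact/continuous_subspaceT/cis_continuous.
Qed.

Lemma circle_unif_continuous f : ccont f -> forall e : R, 0 < e ->
  exists2 d : R, 0 < d & forall z w,
    normc (circle_val z - circle_val w) < d -> normc (f z - f w) < e.
Proof.
move=> /circle_continuousP cf e e0.
have /compact_near_coveringP H := circle_compact.
have : \forall d \near (0 : R)^'+, [set: circle R] `<=`
    (fun z => forall w, normc (circle_val z - circle_val w) < d ->
      normc (f z - f w) < e).
  apply: H => z _.
  have [d d0 fd] := cf z (e / 2) (divr_gt0 e0 (ltr0Sn _ _)).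
  have d20 : 0 < d / 2 by rewrite divr_gt0.
  have H1 : \forall z' \near z, normc (circle_val z - circle_val z') < d / 2.
    by apply/nbhs_circleP; exists (d / 2).
  near=> z' d' => w z'w.
  have z'd : normc (circle_val z - circle_val z') < d / 2.
    by near: z'.
  have d'd : d' < d / 2 by near: d'; exact: nbhs_right_lt.
  have -> : f z' - f w = (f z' - f z) + (f z - f w) by rewrite addrA subrK.
  apply: le_lt_trans (le_normcD _ _) _; rewrite (splitr e) ltrD//.
    by rewrite normcB fd// (lt_le_trans z'd)//; move: d0; lra.
  apply: fd.
  have -> : circle_val z - circle_val w =
    (circle_val z - circle_val z') + (circle_val z' - circle_val w).
    by rewrite addrA subrK.
  apply: le_lt_trans (le_normcD _ _) _; rewrite (splitr d) ltrD//.
  exact: lt_trans z'w d'd.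
move=> Hd; have : \forall d \near (0:R)^'+, 0 < d /\ [set: circle R] `<=`
    (fun z => forall w, normc (circle_val z - circle_val w) < d ->
      normc (f z - f w) < e).
  by near=> d; split; near: d => //; exact: nbhs_right_gt.
by move=> /filter_ex[d [d0 dP]]; exists d => // z w; exact: dP.
Unshelve. all: by end_near. Qed.

Lemma circle_bounded f : ccont f ->
  exists2 M : R, 0 <= M & forall z, normc (f z) <= M.
Proof.
move=> cf.
have pp : - pi <= pi :> R by rewrite (le_trans _ (pi_ge0 R))// oppr_le0 pi_ge0.
have bd (h : R -> R) : continuous h ->
    exists M, forall t, t \in `[- pi, pi] -> `|h t| <= M.
  move=> ch.
  have cn : {within `[- pi, pi], continuous (fun t => `|h t|)}.
    apply: continuous_subspaceT => t; apply: continuous_comp; first exact: ch.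
    exact: norm_continuous.
  by have [c _ cM] := EVT_max pp cn; exists `|h c|.
have [M1 h1] := bd _ (Re_cis_continuous cf).
have [M2 h2] := bd _ (Im_cis_continuous cf).
have H z : normc (f z) <= M1 + M2.
  have [t tpi <-] := cis_surj z.
  by apply: le_trans (normc_le _) _; rewrite lerD ?h1 ?h2.
by exists (M1 + M2) => //; apply: le_trans (H (cis 0)); exact: normc_ge0.
Qed.

Lemma pi2_gt0 : 0 < pi *+ 2 :> R.
Proof. by rewrite mulrn_wgt0// pi_gt0. Qed.

Lemma circle_meanD f g : ccont f -> ccont g ->
  circle_mean (fun z => f z + g z) = circle_mean f + circle_mean g.
Proof.
move=> cf cg; rewrite /circle_mean.
have ReD x y : Re (x + y : R[i]) = Re x + Re y by case: x; case: y.
have ImD x y : Im (x + y : R[i]) = Im x + Im y by case: x; case: y.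
under eq_Rintegral do rewrite ReD.
rewrite RintegralD//; last 2 first.
  by apply: continuous_integrable; exact: Re_cis_continuous.
  by apply: continuous_integrable; exact: Re_cis_continuous.
under [X in _ +i* (_ * X)]eq_Rintegral do rewrite ImD.
rewrite RintegralD//; last 2 first.
  by apply: continuous_integrable; exact: Im_cis_continuous.
  by apply: continuous_integrable; exact: Im_cis_continuous.
by rewrite !mulrDr.
Qed.

Lemma circle_meanZ (x : R[i]) f : ccont f ->
  circle_mean (fun z => x * f z) = x * circle_mean f.
Proof.
move=> cf; rewrite /circle_mean.
have iR a : mu.-integrable `[0, pi *+ 2] (EFin \o (fun t => a * Re (f (cis t)))).
  apply: continuous_integrable => t; apply: cvgMr.
  exact: Re_cis_continuous.
have iI a : mu.-integrable `[0, pi *+ 2] (EFin \o (fun t => a * Im (f (cis t)))).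
  apply: continuous_integrable => t; apply: cvgMr.
  exact: Im_cis_continuous.
have iR1 : mu.-integrable `[0, pi *+ 2] (EFin \o (fun t => Re (f (cis t)))).
  exact: continuous_integrable (Re_cis_continuous cf).
have iI1 : mu.-integrable `[0, pi *+ 2] (EFin \o (fun t => Im (f (cis t)))).
  exact: continuous_integrable (Im_cis_continuous cf).
case: x => a b.
have ReM y : Re ((a +i* b) * y : R[i]) = a * Re y - b * Im y by case: y.
have ImM y : Im ((a +i* b) * y : R[i]) = a * Im y + b * Re y by case: y.
under eq_Rintegral do rewrite ReM.
rewrite RintegralB// !RintegralZl//.
under [X in _ +i* (_ * X)]eq_Rintegral do rewrite ImM.
rewrite RintegralD// !RintegralZl//.
by congr (_ +i* _); ring.
Qed.

Lemma circle_mean_le f g : ccont f -> ccont g ->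
  (forall z, normc (f z) <= Re (g z)) ->
  normc (circle_mean f) <= 2 * Re (circle_mean g).
Proof.
move=> cf cg fg.
have H (h : R -> R) : continuous h -> (forall t, `|h t| <= Re (g (cis t))) ->
    `|(pi *+ 2)^-1 * \int[mu]_(t in `[0, pi *+ 2]) h t| <= Re (circle_mean g).
  move=> ch hg; rewrite /= normrM gtr0_norm ?invr_gt0 ?pi2_gt0//.
  rewrite ler_pM2l ?invr_gt0 ?pi2_gt0//.
  apply: le_trans (le_normr_Rintegral _ _) _ => //.
    exact: continuous_integrable.
  apply: le_Rintegral => //.
    apply: continuous_integrable => t; apply: continuous_comp; first exact: ch.
    exact: norm_continuous.
  exact: continuous_integrable (Re_cis_continuous cg).
apply: le_trans (normc_le _) _; rewrite mulr_natl mulr2n lerD//.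
  apply: H; first exact: Re_cis_continuous.
  by move=> t; exact: le_trans (normc_Re _) (fg _).
apply: H; first exact: Im_cis_continuous.
by move=> t; exact: le_trans (normc_Im _) (fg _).
Qed.

Lemma circle_mean_cst (x : R[i]) : circle_mean (fun=> x) = x.
Proof.
rewrite /circle_mean !Rintegral_cst//= lebesgue_measure_itv/= lte_fin pi2_gt0.
rewrite sube0/= !(mulrC _ (pi *+ 2)) !mulKf ?gt_eqF ?pi2_gt0//.
by case: x.
Qed.

Lemma circle_mean_sum (I : Type) (s : seq I) (F : I -> circle R -> R[i]) :
  (forall i, ccont (F i)) ->
  circle_mean (fun z => \sum_(i <- s) F i z) = \sum_(i <- s) circle_mean (F i).
Proof.
move=> cF; elim: s => [|i s IH].
  rewrite big_nil -[RHS]circle_mean_cst; congr circle_mean.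
  by apply/funext => z; rewrite big_nil.
rewrite big_cons -IH -circle_meanD//; last exact: ccont_sum.
by congr circle_mean; apply/funext => z; rewrite big_cons.
Qed.

Lemma circle_val_neq0 z : circle_val z != 0.
Proof. by rewrite -normr_eq0 circle_valP oner_eq0. Qed.

Lemma normc_circleX z (n : int) : normc (circle_val z ^ n) = 1.
Proof.
case: n => n; rewrite /exprz ?normcV normcX normc_circle expr1n ?invr1//.
Qed.

Lemma ccont_valz (n : int) : ccont (fun z => circle_val z ^ n).
Proof.
case: n => n; first exact: ccont_valX.
apply/circle_continuousP => z e e0.
have [d d0 fd] := (circle_continuousP _).1 (@ccont_valX R n.+1) z e e0.
exists d => // w /fd zw; rewrite /exprz.
set x := circle_val z ^+ n.+1; set y := circle_val w ^+ n.+1.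
have x0 : x != 0 by rewrite expf_neq0// circle_val_neq0.
have y0 : y != 0 by rewrite expf_neq0// circle_val_neq0.
have -> : x^-1 - y^-1 = x^-1 * y^-1 * (y - x).
  by field; rewrite x0 y0.
rewrite !normcM !normcV normcB !normcX !normc_circle !expr1n !invr1 !mul1r.
exact: zw.
Qed.

Lemma cis0 : circle_val (cis 0) = 1 :> R[i].
Proof. by rewrite /cis mk_circleE cos0 sin0. Qed.

Lemma mulcE (a b c d : R) :
  (a +i* b) * (c +i* d) = (a * c - b * d) +i* (a * d + b * c) :> R[i].
Proof. by []. Qed.

Lemma invcE (a b : R) : (a +i* b)^-1 =
  (a / (a ^+ 2 + b ^+ 2)) -i* (b / (a ^+ 2 + b ^+ 2)) :> R[i].
Proof. by []. Qed.

Lemma cisX t (n : nat) :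
  circle_val (cis t) ^+ n = circle_val (cis (n%:R * t)) :> R[i].
Proof.
elim: n => [|n IH]; first by rewrite mul0r cis0.
rewrite exprS IH /cis !mk_circleE -natr1 mulrDl mul1r cosD sinD.
by rewrite mulcE; congr (_ +i* _); ring.
Qed.

Lemma cisz t (n : int) :
  circle_val (cis t) ^ n = circle_val (cis (n%:~R * t)) :> R[i].
Proof.
case: n => n; first by rewrite -exprnP cisX.
rewrite /exprz cisX NegzE mulrNz mulNr /cis !mk_circleE cosN sinN.
by rewrite invcE cos2Dsin2 !divr1.
Qed.

Lemma Rintegral_primitive0 (F f : R -> R) (a b : R) : a < b ->
  (forall x : R, is_derive x (1 : R) F (f x)) -> continuous f -> F a = F b ->
  \int[mu]_(t in `[a, b]) f t = 0.
Proof.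
move=> ab dF cf Fab; rewrite /Rintegral (@continuous_FTC2 _ f F)//.
- by rewrite Fab subee.
- exact: continuous_subspaceT.
- have cF : continuous F.
    by move=> x; apply/differentiable_continuous/derivable1_diffP; apply: ex_derive.
  split; first by move=> x _; apply: ex_derive.
    by apply: cvg_at_right_filter; exact: cF.
  by apply: cvg_at_left_filter; exact: cF.
- by move=> x _; rewrite derive1E derive_val.
Qed.

Lemma circle_mean_valz (n : int) :
  circle_mean (fun z => circle_val z ^ n) = (n == 0)%:R.
Proof.
have [->|n0] := eqVneq n 0; first exact: circle_mean_cst.
pose k : R := n%:~R.
have k0 : k != 0 by rewrite intr_eq0.
have /(congr1 (@circle_val R)) : cis (pi *+ 2) = cis 0 :> circle R.
  by apply: circle_val_inj; rewrite /cis !mk_circleE cos2pi sin2pi cos0 sin0.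
move=> /(congr1 (fun x => x ^ n)); rewrite !cisz mulr0 => -[cE sE].
have cc : continuous (fun t => cos (k * t)).
  move=> t; apply: (@continuous_comp _ _ _ (fun t => k * t) cos).
    by apply: cvgMr.
  exact: continuous_cos.
have cs : continuous (fun t => sin (k * t)).
  move=> t; apply: (@continuous_comp _ _ _ (fun t => k * t) sin).
    by apply: cvgMr.
  exact: continuous_sin.
have dk (x : R) : is_derive x (1 : R) (fun t : R => k * t) k.
  by apply: is_derive_eq; rewrite /GRing.scale/= mulr1.
have dS (x : R) : is_derive x (1 : R) (fun t => k^-1 * sin (k * t)) (cos (k * x)).
  by apply: is_derive_eq; rewrite /GRing.scale/=; field.
have dC (x : R) : is_derive x (1 : R) (fun t => - (k^-1 * cos (k * t))) (sin (k * x)).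
  by apply: is_derive_eq; rewrite /GRing.scale/=; field.
rewrite /circle_mean.
under eq_Rintegral do rewrite cisz /=.
rewrite (Rintegral_primitive0 (pi2_gt0) dS cc); last by rewrite mulr0 sE.
under [X in _ +i* (_ * X)]eq_Rintegral do rewrite cisz /=.
rewrite (Rintegral_primitive0 (pi2_gt0) dC cs); last by rewrite mulr0 cE.
by rewrite !mulr0.
Qed.

End Mean.

Arguments circle_mean : simpl never.
Arguments fourier : simpl never.

Lemma esum_seq_le (R : realType) (T : choiceType) (f : T -> \bar R) (x : \bar R) :
  (forall s : seq T, uniq s -> (\sum_(i <- s) f i <= x)%E) ->
  (\esum_(i in [set: T]) f i <= x)%E.
Proof.
move=> H; apply: ge_ereal_sup => _ [A [fA _] <-].
by rewrite fsbig_finite//=; exact: H.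
Qed.

Lemma esum_seq_ge (R : realType) (T : choiceType) (f : T -> \bar R) (s : seq T) :
  uniq s -> (\sum_(i <- s) f i <= \esum_(i in [set: T]) f i)%E.
Proof.
move=> us; apply: esum_ge; exists [set` s]; first by split.
by rewrite fsbig_seq.
Qed.

Section Wiener.
Variable R : realType.
Implicit Types (z w : circle R) (f g : circle R -> R[i]).
Implicit Types (p q : seq (int * R[i])).
Local Notation ccont f := (continuous (f : circle R -> R[i]^o)).

Definition tpoly p z : R[i] := \sum_(x <- p) x.2 * circle_val z ^ x.1.
Definition tweight p : R := \sum_(x <- p) normc x.2.

Lemma tweight_ge0 p : 0 <= tweight p.
Proof. by apply: sumr_ge0 => i _; exact: normc_ge0. Qed.

Lemma tpoly_le p z : normc (tpoly p z) <= tweight p.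
Proof.
apply: le_trans (normc_sum _ _) _; apply: ler_sum => i _.
by rewrite normcM normc_circleX mulr1.
Qed.

Lemma ccont_tpoly p : ccont (tpoly p).
Proof.
apply: ccont_sum => x; apply: ccontZ; exact: ccont_valz.
Qed.

Lemma fourierD f g n : ccont f -> ccont g ->
  fourier (fun z => f z + g z) n = fourier f n + fourier g n.
Proof.
move=> cf cg; rewrite /fourier -circle_meanD; last 2 first.
- exact: ccontM cf (@ccont_valz _ _).
- exact: ccontM cg (@ccont_valz _ _).
by congr circle_mean; apply/funext => z; rewrite mulrDl.
Qed.

Lemma ccontB f g : ccont f -> ccont g -> ccont (fun z => f z - g z).
Proof.
move=> cf cg; have := ccontD cf (ccontZ (t := -1) cg).
by under eq_fun do rewrite mulN1r.
Qed.

Lemma fourierB f g n : ccont f -> ccont g ->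
  fourier (fun z => f z - g z) n = fourier f n - fourier g n.
Proof.
move=> cf cg; have cB := ccontB cf cg.
have E : (fun z => f z - g z + g z) = f by apply/funext => z; rewrite subrK.
by have := fourierD n cB cg; rewrite E => ->; rewrite addrK.
Qed.

Lemma fourier_le f n (e : R) : ccont f -> (forall z, normc (f z) <= e) ->
  normc (fourier f n) <= 2 * e.
Proof.
move=> cf fe; have -> : 2 * e = 2 * Re (circle_mean (fun _ : circle R => e%:C)).
  by rewrite circle_mean_cst.
apply: circle_mean_le.
- exact: ccontM cf (@ccont_valz _ _).
- exact: ccont_cst.
- by move=> z; rewrite normcM normc_circleX mulr1.
Qed.

Lemma fourier_tpoly p n :
  fourier (tpoly p) n = \sum_(x <- p) x.2 * (x.1 == n)%:R.
Proof.
rewrite /fourier; under eq_fun do rewrite /tpoly mulr_suml.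
rewrite circle_mean_sum; last first.
  move=> x; apply: ccontM; last exact: ccont_valz.
  by apply: ccontZ; exact: ccont_valz.
apply: eq_bigr => x _; rewrite -subr_eq0 -circle_mean_valz -circle_meanZ//.
  congr circle_mean; apply/funext => z.
  by rewrite -mulrA -expfzDr// circle_val_neq0.
exact: ccont_valz.
Qed.

Lemma normw_ge0 f : (0 <= normw f)%E.
Proof. by apply: esum_ge0 => n _; rewrite lee_fin normc_ge0. Qed.

Lemma normw_approx f (r : R) : ccont f ->
  (forall e : R, 0 < e -> exists2 p, tweight p <= r &
    forall z, normc (f z - tpoly p z) <= e) ->
  (normw f <= r%:E)%E.
Proof.
move=> cf H; apply: esum_seq_le => s us.
rewrite sumEFin lee_fin; apply/ler_addgt0Pr => e e0.
pose d := e / (2 * ((size s)%:R + 1)).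
have s0 : 0 <= (size s)%:R :> R by exact: ler0n.
have d0 : 0 < d by rewrite divr_gt0// mulr_gt0// ltr_pwDr.
have [p pr pf] := H d d0.
have Hn n : normc (fourier f n) <= normc (fourier (tpoly p) n) + 2 * d.
  have ct := @ccont_tpoly p.
  have cd := ccontB cf ct.
  have -> : fourier f n = fourier (tpoly p) n + fourier (fun z => f z - tpoly p z) n.
    by rewrite (fourierB n cf ct) addrC subrK.
  apply: le_trans (le_normcD _ _) _; rewrite lerD2l; exact: fourier_le.
apply: le_trans (ler_sum _ (fun n _ => Hn n)) _.
rewrite big_split big_const_seq count_predT iter_addr_0 -(mulr_natr _ (size s)) lerD//.
  apply: le_trans pr.
  apply: (@le_trans _ _ (\sum_(n <- s) \sum_(x <- p) normc x.2 * (x.1 == n)%:R)).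
    apply: ler_sum => n _. rewrite fourier_tpoly.
    apply: le_trans (normc_sum _ _) _; apply: ler_sum => x _.
    rewrite normcM; case: eqP => _; first by rewrite normc1.
    by rewrite normc0.
  rewrite exchange_big/=; apply: ler_sum => x _; rewrite -mulr_sumr.
  rewrite -[leRHS]mulr1 ler_wpM2l ?normc_ge0//.
  rewrite -natr_sum lern1.
  have -> : (\sum_(n <- s) (x.1 == n) = count_mem x.1 s)%N.
    rewrite -sum1_count [RHS]big_mkcond/=; apply: eq_bigr => n _.
    by rewrite eq_sym; case: eqP.
  by rewrite count_uniq_mem// leq_b1.
rewrite /d; have -> : 2 * (e / (2 * ((size s)%:R + 1))) * (size s)%:R =
   e * ((size s)%:R / ((size s)%:R + 1)) by field; lra.
by rewrite ger_pMr// ler_pdivrMr ?ltr_pwDr// mul1r lerDl.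
Qed.

Definition fejer (K : nat) w : R[i] :=
  K%:R^-1 * \sum_(j < K) \sum_(l < K) circle_val w ^ (j%:Z - l%:Z).

Definition fejer_sum f K : seq (int * R[i]) :=
  [seq (x.1%:Z - x.2%:Z, K%:R^-1 * fourier f (x.1%:Z - x.2%:Z))
     | x : nat * nat <- allpairs pair (iota 0 K) (iota 0 K)].

Lemma fejer_weight f K (r : R) : (normw f <= r%:E)%E -> (0 < K)%N ->
  tweight (fejer_sum f K) <= r.
Proof.
move=> fr K0; rewrite /tweight /fejer_sum big_map big_allpairs/=.
have K0' : 0 < K%:R :> R by rewrite ltr0n.
have nK : normc (K%:R^-1 : R[i]) = K%:R^-1.
  by rewrite normcV -(rmorph_nat (real_complex R)) normc_real ger0_norm// ltW.
apply: (@le_trans _ _ (\sum_(j <- iota 0 K) K%:R^-1 * r)); last first.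
  rewrite big_const_seq count_predT size_iota iter_addr_0.
  by rewrite -[leLHS]mulr_natl mulVKf// gt_eqF.
apply: ler_sum => j _; under eq_bigr do rewrite normcM nK.
rewrite -mulr_sumr ler_pM2l ?invr_gt0//.
rewrite -lee_fin; apply: le_trans fr.
have := @esum_seq_ge R int (fun n => (normc (fourier f n))%:E)
  [seq j%:Z - l%:Z | l <- iota 0 K].
rewrite big_map sumEFin; apply.
rewrite map_inj_uniq ?iota_uniq//.
by move=> a b /= /addrI /oppr_inj [].
Qed.

Lemma fejerE K w : fejer K w =
  (K%:R^-1 * normc (\sum_(j < K) circle_val w ^+ j) ^+ 2)%:C.
Proof.
rewrite /fejer rmorphM/= rmorphXn/= fmorphV rmorph_nat; congr (_ * _).
change ((normc (\sum_(j < K) circle_val w ^+ j))%:C) with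
  (`|\sum_(j < K) circle_val w ^+ j|).
rewrite sqr_normc rmorph_sum big_distrlr/=.
apply: eq_bigr => j _; apply: eq_bigr => l _.
rewrite expfzDr ?circle_val_neq0// exprnP; congr (_ * _).
rewrite -invr_expz -exprnP rmorphXn -exprVn; congr (_ ^+ _).
by rewrite invc_norm circle_valP expr1n invr1 mul1r.
Qed.

Lemma fejer_re K w : fejer K w = (Re (fejer K w))%:C.
Proof. by rewrite fejerE. Qed.

Lemma fejer_ge0 K w : 0 <= Re (fejer K w).
Proof. by rewrite fejerE /= mulr_ge0// ?invr_ge0 ?ler0n// sqr_ge0. Qed.

Lemma normc_fejer K w : normc (fejer K w) = Re (fejer K w).
Proof. by rewrite fejer_re normc_real ger0_norm// fejer_ge0. Qed.

Lemma fejer_far K w (d : R) : 0 < d -> d <= normc (1 - circle_val w) ->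
  (0 < K)%N -> Re (fejer K w) <= 4 / (K%:R * d ^+ 2).
Proof.
move=> d0 dw K0; rewrite fejerE /=.
have K0' : 0 < K%:R :> R by rewrite ltr0n.
rewrite invfM [leRHS]mulrCA ler_pM2l ?invr_gt0// ler_pdivlMr ?exprn_gt0//.
rewrite -exprMn.
have -> : 4 = 2 ^+ 2 :> R by rewrite -natrX.
rewrite ler_pXn2r ?nnegrE ?mulr_ge0 ?normc_ge0 ?(ltW d0)//.
apply: (@le_trans _ _ (normc (1 - circle_val w ^+ K))).
  have -> : 1 - circle_val w ^+ K = (1 - circle_val w) * \sum_(j < K) circle_val w ^+ j.
    rewrite -{1}(expr1n _ K) subrXX; congr (_ * _); apply: eq_bigr => j _.
    by rewrite expr1n mul1r.
  by rewrite normcM mulrC ler_wpM2r// normc_ge0.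
apply: le_trans (le_normcD _ _) _.
by rewrite normcN normc1 normcX normc_circle expr1n.
Qed.

End Wiener.

Section Wiener2.
Variable R : realType.
Implicit Types (z w : circle R) (f g : circle R -> R[i]).
Implicit Types (p q : seq (int * R[i])).
Local Notation ccont f := (continuous (f : circle R -> R[i]^o)).

Lemma circle_div_subproof z w : `|circle_val z * (circle_val w)^-1| = 1.
Proof. by rewrite normrM normfV !circle_valP invr1 mulr1. Qed.

Definition circle_div z w : circle R := mk_circle (circle_div_subproof z w).

Lemma tpoly_fejer f K w : ccont f -> tpoly (fejer_sum f K) w =
  circle_mean (fun z => f z * fejer K (circle_div w z)).
Proof.
move=> cf.
pose F (x : nat * nat) z := (K%:R^-1 * circle_val w ^ (x.1%:Z - x.2%:Z)) *
  (f z * circle_val z ^ (- (x.1%:Z - x.2%:Z))).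
have cF x : ccont (fun z => f z * circle_val z ^ (- (x.1%:Z - x.2%:Z))).
  exact: (ccontM cf (@ccont_valz _ _)).
transitivity (circle_mean (fun z =>
    \sum_(x <- allpairs pair (iota 0 K) (iota 0 K)) F x z)).
  rewrite circle_mean_sum; last by move=> x; exact: ccontZ (cF x).
  rewrite /tpoly /fejer_sum big_map; apply: eq_bigr => x _.
  rewrite (circle_meanZ _ (cF x)) /=.
  by rewrite /fourier mulrAC.
congr circle_mean; apply/funext => z.
rewrite big_allpairs /fejer mulrCA mulr_sumr.
rewrite -(big_mkord xpredT (fun j => f z * \sum_(l < K)
  circle_val (circle_div w z) ^ (j%:Z - l%:Z))).
rewrite mulr_sumr /index_iota subn0; apply: eq_bigr => j _.
rewrite -(big_mkord xpredT (fun l => circle_val (circle_div w z) ^ (j%:Z - l%:Z))).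
rewrite !mulr_sumr /index_iota subn0; apply: eq_bigr => l _.
rewrite /F /= /circle_div mk_circleE expfzMl exprz_inv -!mulrA; congr (_ * _).
by rewrite mulrCA.
Qed.

Lemma ccont_fejer K w : ccont (fun z => fejer K (circle_div w z)).
Proof.
have -> : (fun z => fejer K (circle_div w z)) =
   (fun z => K%:R^-1 * \sum_(j < K) \sum_(l < K)
      circle_val w ^ (j%:Z - l%:Z) * circle_val z ^ (- (j%:Z - l%:Z))).
  apply/funext => z; rewrite /fejer; congr (_ * _).
  apply: eq_bigr => j _; apply: eq_bigr => l _.
  by rewrite /circle_div mk_circleE expfzMl exprz_inv.
apply: ccontZ; apply: ccont_sum => j; apply: ccont_sum => l.
by apply: ccontZ; exact: ccont_valz.
Qed.

Lemma circle_mean_fejer K w : (0 < K)%N ->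
  circle_mean (fun z => fejer K (circle_div w z)) = 1.
Proof.
move=> K0.
have -> : (fun z => fejer K (circle_div w z)) =
    (fun z => (fun=> 1) z * fejer K (circle_div w z)).
  by apply/funext => z; rewrite mul1r.
rewrite -tpoly_fejer; last exact: ccont_cst.
rewrite /tpoly /fejer_sum big_map big_allpairs.
have K0' : K%:R != 0 :> R[i] by rewrite pnatr_eq0 -lt0n.
rewrite (eq_big_seq (fun=> K%:R^-1)).
  by rewrite big_const_seq count_predT size_iota iter_addr_0 -[LHS]mulr_natl divff.
move=> j jK /=.
have f1 n : fourier (fun _ : circle R => 1) n = (n == 0)%:R.
  rewrite /fourier; under eq_fun do rewrite mul1r.
  by rewrite circle_mean_valz oppr_eq0.
rewrite (bigD1_seq j) ?iota_uniq//= big1.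
  by rewrite f1 subrr eqxx mulr1 mulr1 addr0.
by move=> l lj; rewrite f1 subr_eq0 eqz_nat eq_sym (negbTE lj) mulr0 mul0r.
Qed.

Lemma fejer_approx f (r : R) : ccont f -> (normw f <= r%:E)%E ->
  forall e : R, 0 < e -> exists2 p, tweight p <= r &
    forall w, normc (f w - tpoly p w) <= e.
Proof.
move=> cf fr e e0.
have e40 : 0 < e / 4 by rewrite divr_gt0.
have [d d0 fd] := circle_unif_continuous cf e40.
have [M M0 fM] := circle_bounded cf.
pose K := (Num.truncn (32 * M / (e * d ^+ 2))).+1.
have KM : 32 * M / (e * d ^+ 2) <= K%:R by apply/ltW; exact: truncnS_gt.
have K0 : (0 < K)%N by [].
have K0' : 0 < K%:R :> R by rewrite ltr0n.
pose c : R := 2 * M * (4 / (K%:R * d ^+ 2)).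
have c0 : 0 <= c.
  apply: mulr_ge0; first exact: mulr_ge0.
  apply: divr_ge0; first exact: ler0n.
  apply: mulr_ge0; [exact: ler0n|exact: sqr_ge0].
have ce : c <= e / 4.
  have d20 : 0 < d ^+ 2 by rewrite exprn_gt0.
  move: KM; rewrite ler_pdivrMr ?mulr_gt0// => KM.
  rewrite /c mulrA ler_pdivrMr ?mulr_gt0//.
  by move: KM; set D := d ^+ 2; set k := K%:R; lra.
exists (fejer_sum f K); first exact: fejer_weight.
move=> w; rewrite tpoly_fejer//.
have cF := @ccont_fejer K w.
have cfF := ccontM cf cF.
have cwF := ccontZ (t := f w) cF.
have -> : f w - circle_mean (fun z => f z * fejer K (circle_div w z)) =
    circle_mean (fun z => (f w - f z) * fejer K (circle_div w z)).
  have cB := ccontM (ccontB (@ccont_cst R (f w)) cf) cF.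
  have E := circle_meanD cB cfF.
  apply/eqP; rewrite subr_eq -E; apply/eqP.
  rewrite -[LHS]mulr1 -(circle_mean_fejer w K0) -circle_meanZ//.
  congr circle_mean; apply/funext => z.
  by rewrite -mulrDl subrK.
pose G z : R[i] := (e / 4)%:C * fejer K (circle_div w z) + c%:C.
have cG : ccont G by exact: ccontD (ccontZ cF) (@ccont_cst _ _).
have mG : circle_mean G = (e / 4 + c)%:C.
  rewrite /G circle_meanD; last 2 first.
  - exact: (ccontZ cF).
  - exact: ccont_cst.
  by rewrite circle_meanZ// circle_mean_fejer// circle_mean_cst mulr1 rmorphD.
have cg : ccont (fun z => (f w - f z) * fejer K (circle_div w z)).
  exact: ccontM (ccontB (@ccont_cst R (f w)) cf) cF.
apply: le_trans (circle_mean_le cg cG _) _.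
  move=> z; rewrite normcM normc_fejer /G.
  have -> : Re ((e / 4)%:C * fejer K (circle_div w z) + c%:C) =
      e / 4 * Re (fejer K (circle_div w z)) + c.
    by rewrite fejer_re -rmorphM -rmorphD.
  have F0 := fejer_ge0 K (circle_div w z).
  have [wz|wz] := ltP (normc (circle_val w - circle_val z)) d.
    rewrite -[leLHS]addr0 lerD// ler_wpM2r// ltW//.
    exact: fd.
  apply: (@le_trans _ _ c); last by rewrite lerDr mulr_ge0// ltW.
  rewrite /c ler_pM ?normc_ge0//.
    apply: le_trans (le_normcD _ _) _.
    by rewrite normcN mulr_natl mulr2n lerD.
  apply: fejer_far => //; apply: le_trans wz _.
  rewrite /circle_div mk_circleE.
  have -> : 1 - circle_val w * (circle_val z)^-1 =
      (circle_val z)^-1 * (circle_val z - circle_val w).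
    by rewrite mulrBr mulVf ?circle_val_neq0// mulrC.
  by rewrite normcM normcV normc_circle invr1 mul1r normcB.
rewrite mG /=.
by move: ce; lra.
Qed.

Lemma normw_fin f : (normw f < +oo)%E -> exists2 r, 0 <= r & normw f = r%:E.
Proof.
move=> fo; have := normw_ge0 f; case: (normw f) fo => [r| |]//.
by move=> _; rewrite lee_fin => r0; exists r.
Qed.

Lemma normwD f g : ccont f -> ccont g -> (normw f < +oo)%E -> (normw g < +oo)%E ->
  (normw (fun z => (f z + g z)%R) <= normw f + normw g)%E.
Proof.
move=> cf cg /normw_fin[r r0 fr] /normw_fin[s s0 gs].
rewrite fr gs -EFinD; apply: normw_approx; first exact: ccontD.
move=> e e0; have e20 : 0 < e / 2 by rewrite divr_gt0.
have [p pr pf] : exists2 p, tweight p <= r &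
    forall z, normc (f z - tpoly p z) <= e / 2.
  by apply: fejer_approx => //; rewrite fr.
have [q qr qg] : exists2 p, tweight p <= s &
    forall z, normc (g z - tpoly p z) <= e / 2.
  by apply: fejer_approx => //; rewrite gs.
exists (p ++ q); first by rewrite /tweight big_cat lerD.
move=> z; rewrite /tpoly big_cat/= -/(tpoly p z) -/(tpoly q z).
have -> : f z + g z - (tpoly p z + tpoly q z) =
  (f z - tpoly p z) + (g z - tpoly q z) by ring.
by apply: le_trans (le_normcD _ _) _; rewrite (splitr e) lerD.
Qed.

Lemma normwZ t f : ccont f -> (normw f < +oo)%E ->
  (normw (fun z => (t * f z)%R) <= (normc t)%:E * normw f)%E.
Proof.
move=> cf /normw_fin[r r0 fr].
rewrite fr -EFinM; apply: normw_approx; first exact: ccontZ.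
move=> e e0.
have t1 : 0 < normc t + 1 by rewrite ltr_wpDl ?normc_ge0.
have [p pr pf] : exists2 p, tweight p <= r &
    forall z, normc (f z - tpoly p z) <= e / (normc t + 1).
  by apply: fejer_approx => //; rewrite ?fr// divr_gt0.
exists [seq (x.1, t * x.2) | x <- p].
  rewrite /tweight big_map; under eq_bigr do rewrite normcM.
  by rewrite -mulr_sumr ler_wpM2l ?normc_ge0.
move=> z; rewrite /tpoly big_map; under eq_bigr do rewrite -mulrA.
rewrite -mulr_sumr -/(tpoly p z) -mulrBr normcM.
apply: (@le_trans _ _ ((normc t + 1) * (e / (normc t + 1)))).
  by rewrite ler_pM ?normc_ge0// lerDl.
by rewrite mulrCA divff ?mulr1// gt_eqF.
Qed.

Lemma normwM f g : ccont f -> ccont g -> (normw f < +oo)%E -> (normw g < +oo)%E ->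
  (normw (fun z => (f z * g z)%R) <= normw f * normw g)%E.
Proof.
move=> cf cg /normw_fin[r r0 fr] /normw_fin[s s0 gs].
rewrite fr gs -EFinM; apply: normw_approx; first exact: ccontM.
move=> e e0; pose d := Num.min 1 (e / (r + s + 1)).
have rs0 : 0 < r + s + 1 by rewrite ltr_wpDl ?addr_ge0.
have d0 : 0 < d by rewrite lt_min ltr01 divr_gt0.
have [p pr pf] : exists2 p, tweight p <= r &
    forall z, normc (f z - tpoly p z) <= d.
  by apply: fejer_approx => //; rewrite fr.
have [q qr qg] : exists2 p, tweight p <= s &
    forall z, normc (g z - tpoly p z) <= d.
  by apply: fejer_approx => //; rewrite gs.
pose m (x y : int * R[i]) := (x.1 + y.1, x.2 * y.2).
exists [seq m x.1 x.2 | x <- allpairs pair p q].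
  rewrite /tweight big_map big_allpairs.
  apply: (@le_trans _ _ (tweight p * tweight q)); last first.
    by rewrite ler_pM ?tweight_ge0.
  rewrite [leRHS]mulr_suml; apply: ler_sum => x _; rewrite mulr_sumr.
  by apply: ler_sum => y _; rewrite normcM.
move=> z.
have -> : tpoly [seq m x.1 x.2 | x <- allpairs pair p q] z = tpoly p z * tpoly q z.
  rewrite /tpoly big_map big_allpairs mulr_suml; apply: eq_bigr => x _.
  rewrite mulr_sumr; apply: eq_bigr => y _.
  by rewrite /m/= expfzDr ?circle_val_neq0// mulrACA.
have -> : f z * g z - tpoly p z * tpoly q z =
   (f z - tpoly p z) * (g z - tpoly q z) +
   ((f z - tpoly p z) * tpoly q z + tpoly p z * (g z - tpoly q z)) by ring.
have pz := le_trans (tpoly_le p z) pr.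
have qz := le_trans (tpoly_le q z) qr.
apply: le_trans (le_normcD _ _) _.
apply: le_trans (lerD (lexx _) (le_normcD _ _)) _.
rewrite !normcM.
apply: (@le_trans _ _ (d * 1 + (d * s + r * d))).
  have d1 : d <= 1 by rewrite ge_min lexx.
  rewrite !lerD// ler_pM ?normc_ge0//.
  exact: le_trans (qg z) d1.
have -> : d * 1 + (d * s + r * d) = d * (r + s + 1) by ring.
by rewrite -ler_pdivlMr// ge_min lexx orbT.
Qed.

Lemma normw_exp n f : ccont f -> (normw f < +oo)%E ->
  (normw (fun z => f (circle_exp z n)) <= normw f)%E.
Proof.
move=> cf /normw_fin[r r0 fr].
rewrite fr; apply: normw_approx; first exact: ccont_exp.
move=> e e0.
have [p pr pf] : exists2 p, tweight p <= r &
    forall z, normc (f z - tpoly p z) <= e.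
  by apply: fejer_approx => //; rewrite fr.
exists [seq (n%:Z * x.1, x.2) | x <- p]; first by rewrite /tweight big_map.
move=> z; have -> : tpoly [seq (n%:Z * x.1, x.2) | x <- p] z =
    tpoly p (circle_exp z n).
  rewrite /tpoly big_map; apply: eq_bigr => x _ /=.
  by rewrite circle_expE -exprz_exp exprnP.
exact: pf.
Qed.

Lemma in_A_subalg : GRing.subalg_closed (@in_A R).
Proof.
have N1 : (normw (fun _ : circle R => 1%R) <= 1%:E)%E.
  apply: normw_approx; first exact: ccont_cst.
  move=> e e0; exists [:: (0%Z, 1)]; first by rewrite /tweight big_seq1 normc1.
  by move=> z; rewrite /tpoly big_seq1 expr0z mulr1 subrr normc0 ltW.
have N1' : (normw (fun _ : circle R => 1%R) < +oo)%E.
  by apply: le_lt_trans N1 _; exact: ltry.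
apply: (@gen_subalg_closed R (@wiener R) (@normw R)).
- by split => //; exact: ccont_cst.
- move=> f g [cf fo] [cg go]; split; first exact: ccontD.
  by apply: le_lt_trans (normwD cf cg fo go) _; exact: lte_add_pinfty.
- move=> f g [cf fo] [cg go]; split; first exact: ccontM.
  apply: le_lt_trans (normwM cf cg fo go) _; apply: lte_mul_pinfty => //.
    exact: normw_ge0.
  by rewrite ge0_fin_numE// normw_ge0.
- move=> t f [cf fo]; split; first exact: ccontZ.
  apply: le_lt_trans (normwZ t cf fo) _; apply: lte_mul_pinfty => //.
  by rewrite lee_fin normc_ge0.
- move=> n f _ [cf fo]; split; first exact: ccont_exp.
  exact: le_lt_trans (normw_exp n cf fo) fo.
- exact: normw_ge0.
- apply/eqP; rewrite eq_le normw_ge0 andbT; apply: normw_approx.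
    exact: ccont_cst.
  move=> e e0; exists [::]; first by rewrite /tweight big_nil.
  by move=> z; rewrite /tpoly big_nil subrr normc0 ltW.
- exact: N1'.
- by move=> f g [cf fo] [cg go]; exact: normwD.
- by move=> f g [cf fo] [cg go]; exact: normwM.
- by move=> t f [cf fo]; exact: normwZ.
- by move=> n f _ [cf fo]; exact: normw_exp.
Qed.

End Wiener2.

HB.instance Definition _ (R : realType) :=
  GRing.isSubalgClosed.Build R[i] (fseries R) (@in_A R)
    (GRing.subalg_closed_semi (in_A_subalg R)).

HB.instance Definition _ (R : realType) :=
  GRing.isSubalgClosed.Build R[i] (fseries R) (@in_B R)
    (GRing.subalg_closed_semi (in_B_subalg R)).

Record algA (R : realType) :=
  AlgA { algA_val :> fseries R; _ : algA_val \in @in_A R }.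

HB.instance Definition _ (R : realType) := [isSub for @algA_val R].
HB.instance Definition _ (R : realType) := [Choice of algA R by <:].
HB.instance Definition _ (R : realType) :=
  [SubChoice_isSubAlgebra of algA R by <:].

Record algB (R : realType) :=
  AlgB { algB_val :> fseries R; _ : algB_val \in @in_B R }.

HB.instance Definition _ (R : realType) := [isSub for @algB_val R].
HB.instance Definition _ (R : realType) := [Choice of algB R by <:].
HB.instance Definition _ (R : realType) :=
  [SubChoice_isSubAlgebra of algB R by <:].

(* Main.v *)
Require Import Defs.
From HB Require Import structures.
From mathcomp Require Import all_boot all_order all_algebra complex.
From mathcomp Require Import all_classical all_reals all_analysis.
From mathcomp Require Import ring lra.

(** Both algebras act on spaces of functions on the circle: on [C(T)] for [B], on
    the Wiener algebra [W] for [A]. A coefficient [phi] acts by multiplication and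
    [x] acts as the transfer operator [L] of the squaring map, where [(L f)(z)] is
    the mean of [f] over the two square roots of [z]. Since [phi (L f) = L (g f)]
    with [g(z) = phi(z^2)] ([transferMl]), the formula
    [a f = \sum_m L^m (a_m f)] defines a module; the series converges uniformly, and
    its sum stays in [W] when [a] is in [A] and [f] in [W] ([wiener_acts]).

    The module is irreducible as soon as, for [f <> 0], some [L^n (p f)] is
    invertible ([pfun_irreducible]): then [h x^n p f = 1] for some [h], and [1]
    generates. In [C(T)], take [p] to be the conjugate of [f]: every point has a
    [2^n]-th root in an arc where [f] does not vanish, so [L^n |f|^2 > 0]
    ([ccont_key]). In [W], take [p = z^-k] where the [k]-th Fourier coefficient [c]
    of [f] is nonzero. The [j]-th coefficient of [L^n (z^-k f)] is the coefficient
    of [f] of index [2^n j + k], so [L^n (z^-k f)] tends to [c] in norm and is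
    invertible by a Neumann series ([wiener_key]).

    It is faithful ([pfun_faithful]): if [a] annihilates the powers of
    [(1 + w/z)/2], it annihilates their pointwise limit, the indicator of [z], and
    [L^m] maps that indicator to [2^-m] times the indicator of [z^(2^m)]
    ([transfern_point]). When the points [z^(2^m)] are distinct, it follows that
    [a_m(z) = 0] for all [m], and such points [z] are dense
    ([circle_nonperiodic_near]). *)

Set Implicit Arguments.
Unset Strict Implicit.
Unset Printing Implicit Defensive.

Import Order.TTheory GRing.Theory Num.Theory.
Import numFieldNormedType.Exports.
Import Normc.

Local Open Scope classical_set_scope.
Local Open Scope ring_scope.
Local Open Scope complex_scope.

Local Notation ccont f := (continuous (f : circle _ -> _[i]^o)).

Arguments normc : simpl never.
Arguments circle_val : simpl never.
Arguments mk_circle : simpl never.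
Arguments circle_exp : simpl never.

(** * Roots of points of the circle *)

Section SquareRoots.
Variable R : realType.
Implicit Types (z w u v : circle R).

Lemma circle_opp_subproof z : `|- circle_val z| = 1.
Proof. by rewrite normrN circle_valP. Qed.

Definition circle_opp z : circle R := mk_circle (circle_opp_subproof z).

Lemma circle_mul_subproof z w : `|circle_val z * circle_val w| = 1.
Proof. by rewrite normrM !circle_valP mulr1. Qed.

Definition circle_mul z w : circle R := mk_circle (circle_mul_subproof z w).

Lemma circle_expMl z w n :
  circle_exp (circle_mul z w) n = circle_mul (circle_exp z n) (circle_exp w n).
Proof. by apply: circle_val_inj; rewrite /circle_mul !(circle_expE, mk_circleE) exprMn. Qed.

Lemma circle_exp_opp z : circle_exp (circle_opp z) 2 = circle_exp z 2.
Proof. by apply: circle_val_inj; rewrite !circle_expE mk_circleE sqrrN. Qed.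

Lemma cis_exp (t : R) n : circle_exp (cis t) n = cis (n%:R * t).
Proof. by apply: circle_val_inj; rewrite circle_expE cisX. Qed.

Lemma circle_root_exists z n : (0 < n)%N -> exists w, circle_exp w n = z.
Proof.
move=> n0; have [t _ <-] := cis_surj z; exists (cis (n%:R^-1 * t)).
by rewrite cis_exp mulrA divff ?mul1r// pnatr_eq0 -lt0n.
Qed.

(** Some square root; the constructions below do not depend on the choice. *)
Definition circle_sqrt z : circle R :=
  projT1 (cid (circle_root_exists z (isT : (0 < 2)%N))).

Lemma circle_sqrtK z : circle_exp (circle_sqrt z) 2 = z.
Proof. by rewrite /circle_sqrt; case: cid. Qed.

Lemma circle_exp2_inj u v :
  circle_exp u 2 = circle_exp v 2 -> u = v \/ u = circle_opp v.
Proof.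
move=> /(congr1 (@circle_val R)); rewrite !circle_expE => /eqP.
by rewrite eqf_sqr => /orP[] /eqP uv; [left|right]; apply: circle_val_inj.
Qed.

(** The [2^n]-th roots of a point [w] are equally spaced, so for [n] large,
    uniformly in [w], one of them lies in any given arc. *)
Lemma circle_root_near z (d : R) : 0 < d -> exists n, forall w,
  exists2 u, circle_exp u (2 ^ n) = w &
    normc (circle_val z - circle_val u) < d.
Proof.
move=> d0.
have [e e0 eP] : exists2 e : R, 0 < e & forall t : R, `|t| < e ->
    normc (1 - circle_val (cis t)) < d.
  have /cis_continuous : nbhs (cis (0 : R))
      [set w | normc (circle_val (cis 0) - circle_val w) < d].
    by apply/nbhs_circleP; exists d.
  move=> /nbhs_ballP[e /= e0 eP]; exists e => // t te.
  by rewrite -cis0; apply: (eP t); rewrite /ball/= sub0r normrN.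
(* [w / z^(2^n) = e^(it)] with [|t| <= pi], and [z e^(it / 2^n)] is the root *)
pose n := (Num.truncn (pi / e)).+1.
have ne : pi / e < (2 ^ n)%:R.
  apply: lt_trans (truncnS_gt _) _.
  by rewrite ltr_nat ltn_expl.
have p0 : 0 < (2 ^ n)%:R :> R by rewrite ltr0n expn_gt0.
exists n => w.
have [t] := cis_surj (circle_div w (circle_exp z (2 ^ n))).
rewrite in_itv/= => /andP[t1 t2] tw.
exists (circle_mul z (cis ((2 ^ n)%:R^-1 * t))).
  rewrite circle_expMl cis_exp mulrA divff ?gt_eqF// mul1r tw.
  apply: circle_val_inj; rewrite /circle_mul /circle_div !mk_circleE.
  by rewrite mulrC mulfVK// expf_neq0// circle_val_neq0.
rewrite /circle_mul mk_circleE -[X in X - _]mulr1 -mulrBr normcM normc_circle mul1r.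
apply: eP; rewrite normrM gtr0_norm ?invr_gt0//.
rewrite mulrC ltr_pdivrMr//.
move: ne; rewrite ltr_pdivrMr// mulrC; apply: le_lt_trans.
by rewrite ler_norml t1.
Qed.

Lemma circle_345_subproof : `|(3 / 5) +i* (4 / 5)| = 1 :> R[i].
Proof.
rewrite normc_def /= -[RHS]/((1:R)%:C); congr (_%:C).
rewrite (_ : _ + _ = 1 ^+ 2); last by field.
by rewrite sqrtr_sqr normr1.
Qed.

(** The point [(3 + 4i)/5], which has infinite order in the circle group. *)
Definition circle_345 : circle R := mk_circle circle_345_subproof.

(** [(3 + 4i)^2 = 3 + 4i] modulo 5, hence so is every positive power of it. *)
Lemma circle_345_exp n : exists p q : int,
  5 ^+ n.+1 * circle_val circle_345 ^+ n.+1 =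
  (5 * p + 3)%:~R +i* (5 * q + 4)%:~R.
Proof.
elim: n => [|n [p [q E]]].
  exists 0, 0; rewrite !expr1 /circle_345 mk_circleE.
  rewrite -[5]/(5%:R) -(rmorph_nat (real_complex R)) /= mulcE.
  by congr (_ +i* _); rewrite !rmorphD !rmorphM/=; field.
exists (3 * p - 4 * q - 2), (4 * p + 3 * q + 4).
rewrite exprS (exprS (circle_val _)) mulrACA E /circle_345 mk_circleE.
rewrite -[5]/(5%:R) -(rmorph_nat (real_complex R)) /= !mulcE.
by congr (_ +i* _); rewrite !(rmorphD, rmorphM, rmorphN) /=; field.
Qed.

Lemma circle_345_order n : circle_val circle_345 ^+ n.+1 <> 1.
Proof.
have [p [q E]] := circle_345_exp n => e1; move: E; rewrite e1 mulr1.
rewrite -(rmorph_nat (real_complex R)) -rmorphXn /= => -[_ /esym/eqP].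
rewrite intr_eq0 => /eqP E.
have : (5 %| 4%:Z)%Z.
  have -> : 4%:Z = 5 * (- q) by move: E; lra.
  exact: dvdz_mulr.
by [].
Qed.

Lemma circle_345_inj : injective (circle_exp circle_345).
Proof.
have H m n : (m < n)%N -> circle_exp circle_345 m <> circle_exp circle_345 n.
  move=> mn /(congr1 (@circle_val R)); rewrite !circle_expE.
  have -> : n = ((n - m).-1.+1 + m)%N by rewrite prednK ?subn_gt0// subnK// ltnW.
  rewrite exprD -{1}[_ ^+ m]mul1r => /mulIf E.
  by apply: (@circle_345_order (n - m).-1); rewrite E// expf_neq0// circle_val_neq0.
move=> m n E; have [//|mn] := eqVneq m n.
by have := mn; rewrite neq_ltn => /orP[] /H; rewrite E.
Qed.

(** The points with pairwise distinct iterates under squaring are dense: the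
    [2^n]-th roots of a point of infinite order are such points. *)
Lemma circle_nonperiodic_near z (d : R) : 0 < d ->
  exists2 u, normc (circle_val z - circle_val u) < d &
    injective (fun m => circle_exp u (2 ^ m)).
Proof.
move=> d0; have [n /(_ circle_345)[u un zu]] := circle_root_near z d0.
exists u => // i j /= /(congr1 (fun v => circle_exp v (2 ^ n))).
rewrite !circle_expM ![(2 ^ _ * 2 ^ n)%N]mulnC -!circle_expM un => /circle_345_inj.
by move/expnI => ->.
Qed.

End SquareRoots.

(** * The transfer operator of the squaring map *)

Section Transfer.
Variable R : realType.
Local Notation X := (circle R -> R[i]).
Implicit Types (z w u v : circle R) (f g : X) (c : R[i]).

(** The transfer operator of squaring: [transfer f z] is the average of [f] over
    the two square roots of [z]. *)
Definition transfer f : X := fun z =>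
  2^-1 * (f (circle_sqrt z) + f (circle_opp (circle_sqrt z))).

Lemma circle_oppK : involutive (@circle_opp R).
Proof. by move=> z; apply: circle_val_inj; rewrite /circle_opp !mk_circleE opprK. Qed.

Lemma circle_opp_neq z : circle_opp z <> z.
Proof.
move=> /(congr1 (@circle_val R)); rewrite /circle_opp mk_circleE => /eqP.
by rewrite eq_sym -addr_eq0 -mulr2n mulrn_eq0/= (negbTE (circle_val_neq0 z)).
Qed.

Lemma transfer_sqr f u : transfer f (circle_exp u 2) = 2^-1 * (f u + f (circle_opp u)).
Proof.
rewrite /transfer.
have [->|->] := circle_exp2_inj (circle_sqrtK (circle_exp u 2)); first by [].
by rewrite circle_oppK [f u + _]addrC.
Qed.

Lemma transferD f g : transfer (fun z => f z + g z) =
  (fun z => transfer f z + transfer g z).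
Proof. by apply/funext => z; rewrite /transfer; ring. Qed.

Lemma transferZ c f : transfer (fun z => c * f z) = (fun z => c * transfer f z).
Proof. by apply/funext => z; rewrite /transfer; ring. Qed.

(** The relation [y x = x y^2]: multiplication by [f], applied after the transfer
    operator, equals multiplication by [f(z^2)] applied before it. *)
Lemma transferMl f g :
  transfer (fun z => f (circle_exp z 2) * g z) = (fun z => f z * transfer g z).
Proof.
apply/funext => z; rewrite /transfer circle_exp_opp !circle_sqrtK; ring.
Qed.

Lemma normc_half : normc (2^-1 : R[i]) = 2^-1.
Proof.
by rewrite normcV -[2]/(2%:R) -(rmorph_nat (real_complex R)) normc_real ger0_norm.
Qed.

Lemma normc_avg (x y : R[i]) (e : R) : normc x <= e -> normc y <= e ->
  normc (2^-1 * (x + y)) <= e.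
Proof.
move=> xe ye; rewrite normcM normc_half ler_pdivrMl//.
by apply: le_trans (le_normcD _ _) _; rewrite mulr_natl mulr2n lerD.
Qed.

Lemma transfer_le f z (e : R) :
  (forall u, circle_exp u 2 = z -> normc (f u) <= e) -> normc (transfer f z) <= e.
Proof.
by move=> H; apply: normc_avg; apply: H; rewrite ?circle_exp_opp circle_sqrtK.
Qed.

Lemma ccont_transfer f : ccont f -> ccont (transfer f).
Proof.
move=> cf; apply/circle_continuousP => z e e0.
have e20 : 0 < e / 2 by rewrite divr_gt0.
have [d d0 fd] := circle_unif_continuous cf e20.
exists (d ^+ 2); first by rewrite exprn_gt0.
move=> w.
have [u <-] := circle_root_exists z (isT : (0 < 2)%N).
have [v <-] := circle_root_exists w (isT : (0 < 2)%N).
rewrite !circle_expE subr_sqr normcM => uv.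
(* one of the square roots [v], [- v] of [v^2] is close to [u], as
     [|u - v| |u + v| < d^2]; [transfer_sqr] is symmetric in them *)
wlog uvd : v uv / normc (circle_val u - circle_val v) < d.
  move=> H.
  have [|du] := ltP (normc (circle_val u - circle_val v)) d; first exact: H.
  have [|dv] := ltP (normc (circle_val u + circle_val v)) d.
    have uo : circle_val u + circle_val v = circle_val u - circle_val (circle_opp v).
      by rewrite /circle_opp mk_circleE opprK.
    rewrite uo -(circle_exp_opp v) => uod; apply: H => //.
    by rewrite -uo /circle_opp mk_circleE mulrC.
  by move: uv; rewrite ltNge expr2 ler_pM// ltW.
rewrite !transfer_sqr.
have H1 := fd _ _ uvd.
have H2 : normc (f (circle_opp u) - f (circle_opp v)) < e / 2.
  by apply: fd; rewrite /circle_opp !mk_circleE -opprD normcN.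
apply: (@le_lt_trans _ _ (e / 2)); last by rewrite ltr_pdivrMr// ltr_pMr// ltr1n.
rewrite -mulrBr opprD addrACA; apply: normc_avg; exact: ltW.
Qed.

(** The average over the [2^m]-th roots. *)
Definition transfern m : X -> X := iter m transfer.

Lemma transfernS m f : transfern m.+1 f = transfern m (transfer f).
Proof. by rewrite /transfern iterSr. Qed.

Lemma transfernD m n f : transfern (m + n) f = transfern m (transfern n f).
Proof. exact: iterD. Qed.

Lemma transfern_add m f g : transfern m (fun z => f z + g z) =
  (fun z => transfern m f z + transfern m g z).
Proof. by elim: m f g => // m IH f g; rewrite !transfernS transferD IH. Qed.

Lemma transfern_scale m c f :
  transfern m (fun z => c * f z) = (fun z => c * transfern m f z).
Proof. by elim: m f => // m IH f; rewrite !transfernS transferZ IH. Qed.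

Lemma transfern0 m : transfern m (fun=> 0) = (fun=> 0).
Proof.
have -> : (fun=> 0) = (fun z : circle R => 0 * (fun=> 0 : R[i]) z).
  by apply/funext => z; rewrite mul0r.
by rewrite transfern_scale; apply/funext => z; rewrite !mul0r.
Qed.

Lemma transfern_sum m (I : Type) (s : seq I) (F : I -> X) :
  transfern m (fun z => \sum_(i <- s) F i z) =
  (fun z => \sum_(i <- s) transfern m (F i) z).
Proof.
elim: s => [|i s IH].
  have nil (G : I -> X) : (fun z => \sum_(i <- [::]) G i z) = fun=> 0.
    by apply/funext => z; rewrite big_nil.
  by rewrite !nil transfern0.
have cons (G : I -> X) : (fun z => \sum_(j <- i :: s) G j z) =
    (fun z => G i z + \sum_(j <- s) G j z).
  by apply/funext => z; rewrite big_cons.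
by rewrite !cons transfern_add IH.
Qed.

Lemma transfernMl m f g :
  transfern m (fun z => f (circle_exp z (2 ^ m)) * g z) =
  (fun z => f z * transfern m g z).
Proof.
elim: m f g => [|m IH] f g.
  by apply/funext => z; rewrite /= expn0 circle_exp1.
rewrite !transfernS -IH; congr transfern.
rewrite -(transferMl (fun z => f (circle_exp z (2 ^ m)))); congr transfer.
by apply/funext => z; rewrite circle_expM expnS.
Qed.

Lemma transfern_le m f z (e : R) :
  (forall u, circle_exp u (2 ^ m) = z -> normc (f u) <= e) ->
  normc (transfern m f z) <= e.
Proof.
elim: m f z => [|m IH] f z H; first by apply: H; rewrite circle_exp1.
rewrite transfernS; apply: IH => u uz; apply: transfer_le => v vu.
by apply: H; rewrite expnS -circle_expM vu.
Qed.

Lemma ccont_transfern m f : ccont f -> ccont (transfern m f).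
Proof.
move=> cf; elim: m => [|m IH]; first exact: cf.
exact: (ccont_transfer IH).
Qed.

(** The indicator of a point is mapped to a multiple of the indicator of the
    image of that point. *)
Lemma transfern_point m c z : transfern m (fun w => c * (w == z)%:R) =
  (fun w => 2^-1 ^+ m * c * (w == circle_exp z (2 ^ m))%:R).
Proof.
elim: m c z => [|m IH] c z.
  by apply/funext => w; rewrite expr0 mul1r circle_exp1.
rewrite transfernS.
have -> : transfer (fun w => c * (w == z)%:R) =
    (fun w => 2^-1 * c * (w == circle_exp z 2)%:R).
  apply/funext => w; have [u <-] := circle_root_exists w (isT : (0 < 2)%N).
  rewrite transfer_sqr -mulrDr mulrA; congr (_ * _).
  have [->|uz] := eqVneq u z.
    rewrite eqxx; case: eqP => [/circle_opp_neq//|_]; rewrite addr0 //.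
  rewrite add0r; have [<-|ouz] := eqVneq (circle_opp u) z.
    by rewrite circle_exp_opp eqxx.
  case: eqP => // /circle_exp2_inj[uz'|uz']; first by rewrite uz' eqxx in uz.
  by rewrite uz' circle_oppK eqxx in ouz.
rewrite IH; apply/funext => w.
by rewrite exprSr !mulrA circle_expM -expnS.
Qed.

Lemma transfern_cvg m (F : nat -> X) f :
  (forall z, (F n z : R[i]^o) @[n --> \oo] --> (f z : R[i]^o)) ->
  forall z, (transfern m (F n) z : R[i]^o) @[n --> \oo] --> (transfern m f z : R[i]^o).
Proof.
move=> Ff; elim: m => [|m IH] z; first exact: Ff.
have H := @cvgD _ R[i]^o _ \oo _ _ _ _ _
  (IH (circle_sqrt z)) (IH (circle_opp (circle_sqrt z))).
have H2 := @cvgZ _ R[i]^o _ \oo _ (fun=> 2^-1) _ (2^-1) _ (cvg_cst _) (H _).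
exact: H2.
Qed.

End Transfer.

(** * Uniform convergence and the action of formal series *)

Section UniformConvergence.
Variable R : realType.
Local Notation X := (circle R -> R[i]).
Implicit Types (z w u v : circle R) (f g h : X) (c : R[i]) (s : nat -> X).

(** Uniform convergence on the circle. *)
Definition ucvg s g : Prop := forall e : R, 0 < e ->
  exists n0, forall n, (n0 <= n)%N -> forall z, normc (s n z - g z) <= e.

Lemma normc_eps0 (x : R[i]) : (forall e : R, 0 < e -> normc x <= e) -> x = 0.
Proof.
move=> H; apply: eq0_normc; apply/eqP; rewrite eq_le normc_ge0 andbT.
by apply/ler_addgt0Pr => e e0; rewrite add0r; exact: H.
Qed.

Lemma ucvg_unique s g h : ucvg s g -> ucvg s h -> g = h.
Proof.
move=> sg sh; apply/funext => z; apply/eqP; rewrite -subr_eq0; apply/eqP.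
apply: normc_eps0 => e e0; have e20 : 0 < e / 2 by rewrite divr_gt0.
have [n1 H1] := sg _ e20; have [n2 H2] := sh _ e20.
have -> : g z - h z = - (s (maxn n1 n2) z - g z) + (s (maxn n1 n2) z - h z) by ring.
apply: le_trans (le_normcD _ _) _.
by rewrite normcN (splitr e) lerD ?H1 ?H2 ?leq_maxl ?leq_maxr.
Qed.

Lemma ucvgD s t g h : ucvg s g -> ucvg t h ->
  ucvg (fun n z => s n z + t n z) (fun z => g z + h z).
Proof.
move=> sg th e e0; have e20 : 0 < e / 2 by rewrite divr_gt0.
have [n1 H1] := sg _ e20; have [n2 H2] := th _ e20.
exists (maxn n1 n2) => n; rewrite geq_max => /andP[n1n n2n] z.
by rewrite opprD addrACA; apply: le_trans (le_normcD _ _) _; rewrite (splitr e) lerD ?H1 ?H2.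
Qed.

Lemma ucvg_eventually s g n0 : (forall n, (n0 <= n)%N -> s n = g) -> ucvg s g.
Proof. by move=> H e e0; exists n0 => n /H -> z; rewrite subrr normc0 ltW. Qed.

Lemma ucvg_ccont s g : (forall n, ccont (s n)) -> ucvg s g -> ccont g.
Proof.
move=> cs sg; apply/circle_continuousP => z e e0.
have e40 : 0 < e / 4 by rewrite divr_gt0.
have [n /(_ n (leqnn n)) H] := sg _ e40.
have [d d0 sd] := (circle_continuousP _).1 (cs n) z _ e40.
exists d => // w /sd zw.
have -> : g z - g w = - (s n z - g z) + ((s n z - s n w) + (s n w - g w)) by ring.
apply: le_lt_trans (le_normcD _ _) _.
apply: le_lt_trans (lerD (lexx _) (le_normcD _ _)) _.
have := H z; have := H w; rewrite normcN; lra.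
Qed.

Lemma complex_cauchy (u : nat -> R[i]) :
  (forall e : R, 0 < e -> exists n0, forall n, (n0 <= n)%N -> normc (u n - u n0) <= e) ->
  exists l, forall e : R, 0 < e ->
    exists n0, forall n, (n0 <= n)%N -> normc (u n - l) <= e.
Proof.
move=> H.
have real_lim (p : R[i] -> R) : (forall x y, `|p x - p y| <= normc (x - y)) ->
    exists l, forall e : R, 0 < e ->
    exists n0, forall n, (n0 <= n)%N -> `|p (u n) - l| <= e.
  move=> pl.
  have /cauchy_cvgP/cvg_ex[l pul] : cauchy ((p \o u) @ \oo).
    apply: cauchy_exP => e e0.
    have e20 : 0 < e / 2 by rewrite divr_gt0.
    have [n0 H0] := H _ e20; exists (p (u n0)); exists n0 => // n /= n0n.
    rewrite /ball/= distrC; apply: le_lt_trans (pl _ _) _.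
    by apply: le_lt_trans (H0 _ n0n) _; move: e0; lra.
  exists l => e e0.
  move/cvgrPdist_le : pul => /(_ e e0)[n0 _ H0].
  by exists n0 => n n0n; rewrite distrC; exact: H0.
have [|a Ha] := real_lim (@complex.Re R).
  move=> x y; apply: le_trans (normc_Re _).
  by case: x => ? ?; case: y => ? ?.
have [|b Hb] := real_lim (@complex.Im R).
  move=> x y; apply: le_trans (normc_Im _).
  by case: x => ? ?; case: y => ? ?.
exists (a +i* b) => e e0; have e20 : 0 < e / 2 by rewrite divr_gt0.
have [n1 H1] := Ha _ e20; have [n2 H2] := Hb _ e20.
exists (maxn n1 n2) => n; rewrite geq_max => /andP[/H1 h1 /H2 h2].
apply: le_trans (normc_le _) _; rewrite (splitr e).
by move: h1 h2; case: (u n) => x y /= h1 h2; rewrite lerD.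
Qed.

Lemma ucvg_cauchy s :
  (forall e : R, 0 < e -> exists n0, forall n, (n0 <= n)%N ->
    forall z, normc (s n z - s n0 z) <= e) ->
  exists g, ucvg s g.
Proof.
move=> H.
have /choice[g gP] z := @complex_cauchy (fun n => s n z) (fun e e0 =>
  let: ex_intro n0 H0 := H e e0 in ex_intro _ n0 (fun n n0n => H0 n n0n z)).
exists g => e e0; have e20 : 0 < e / 2 by rewrite divr_gt0.
have [n0 H0] := H _ e20; exists n0 => n n0n z.
have ge : normc (s n0 z - g z) <= e / 2.
  apply/ler_addgt0Pr => d d0; have [n1 H1] := gP z d d0.
  have -> : s n0 z - g z = - (s (maxn n0 n1) z - s n0 z) + (s (maxn n0 n1) z - g z).
    by ring.
  apply: le_trans (le_normcD _ _) _; rewrite normcN lerD//.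
    by rewrite H0// leq_maxl.
  by rewrite H1// leq_maxr.
have -> : s n z - g z = (s n z - s n0 z) + (s n0 z - g z) by ring.
by apply: le_trans (le_normcD _ _) _; rewrite (splitr e) lerD// H0.
Qed.

(** The tails of a bounded series of nonnegative terms are small. *)
Lemma sum_tail (M : nat -> R) (C : R) : (forall m, 0 <= M m) ->
  (forall n, \sum_(0 <= m < n) M m <= C) ->
  forall e : R, 0 < e -> exists n0, forall n, \sum_(n0 <= m < n) M m <= e.
Proof.
move=> M0 MC e e0.
have nd : nondecreasing_seq (fun n => \sum_(0 <= m < n) M m).
  by apply/nondecreasing_seqP => n; rewrite big_nat_recr//= lerDl.
have cv : cvgn (fun n => \sum_(0 <= m < n) M m).
  by apply: nondecreasing_is_cvgn => //; exists C => _ [n _ <-].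
have /cvgrPdist_le/(_ e e0)[n0 _ H0] := cv.
exists n0 => n; have [n0n|nn0] := leqP n0 n; last by rewrite big_geq ?ltW// ltnW.
have /ler_normlW := H0 n0 (leqnn n0).
have := nondecreasing_cvgn_le nd cv n.
by rewrite (@big_cat_nat _ _ _ n0 0 n)//=; lra.
Qed.

End UniformConvergence.

Section Action.
Variable R : realType.
Local Notation X := (circle R -> R[i]).
Implicit Types (z w u v : circle R) (f g h : X) (c : R[i]) (a b : fseries R).

(** The coefficients of [a] are bounded in the uniform norm by the terms of a
    convergent series; this holds in both algebras. *)
Definition dominated a : Prop := exists (M : nat -> R) (C : R),
  (forall m z, normc (a m z) <= M m) /\ (forall n, \sum_(0 <= m < n) M m <= C).

(** The partial sums of the series [\sum_m L^m (a_m f)], [L] being the transfer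
    operator, which is the action of [\sum_m x^m a_m] on [f]. *)
Definition actsum a f n : X :=
  fun z => \sum_(0 <= m < n) transfern m (fun w => a m w * f w) z.

(** [acts a f g]: the function [g] is the result of the action of [a] on [f]. *)
Definition acts a f g : Prop := ucvg (actsum a f) g.

Lemma acts_addl a b f g h : acts a f g -> acts b f h -> acts (a + b) f (fun z => g z + h z).
Proof.
move=> ag bh; have := ucvgD ag bh; rewrite /acts; congr ucvg.
apply/funext => n; apply/funext => z; rewrite /actsum -big_split/=.
apply: eq_bigr => m _; rewrite -[LHS]/((fun z => _ + _) z) -transfern_add.
by congr transfern; apply/funext => w; rewrite fs_addE mulrDl.
Qed.

Lemma acts_addr a f1 f2 g h : acts a f1 g -> acts a f2 h ->
  acts a (fun z => f1 z + f2 z) (fun z => g z + h z).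
Proof.
move=> ag bh; have := ucvgD ag bh; rewrite /acts; congr ucvg.
apply/funext => n; apply/funext => z; rewrite /actsum -big_split/=.
apply: eq_bigr => m _; rewrite -[LHS]/((fun z => _ + _) z) -transfern_add.
by congr transfern; apply/funext => w; rewrite mulrDr.
Qed.

Lemma acts_monomial m p f :
  acts (fs_monomial m p) f (transfern m (fun z => p z * f z)).
Proof.
apply: (@ucvg_eventually _ _ _ m.+1) => n mn; apply/funext => z.
rewrite /actsum (bigD1_seq m) ?iota_uniq ?mem_index_iota//= big1 ?addr0.
  by congr transfern; apply/funext => w; rewrite /fs_monomial eqxx.
move=> i im; have -> : (fun w => fs_monomial m p i w * f w) = (fun=> 0).
  by apply/funext => w; rewrite /fs_monomial (negbTE im) mul0r.
by rewrite transfern0.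
Qed.

Lemma fs_one_monomial : 1 = fs_monomial 0 (fun=> 1) :> fseries R.
Proof.
apply/funext => m; apply/funext => z.
by rewrite -[LHS]/(fs_one m z) /fs_one /fs_monomial; case: eqP.
Qed.

Lemma acts_one f : acts 1 f f.
Proof.
have := @acts_monomial 0 (fun=> 1) f; rewrite -fs_one_monomial.
by under eq_fun do rewrite mul1r.
Qed.

Lemma sum_triangle (F : nat -> nat -> R[i]) n :
  \sum_(0 <= k < n) \sum_(0 <= i < k.+1) F i (k - i)%N =
  \sum_(0 <= i < n) \sum_(0 <= j < n - i) F i j.
Proof.
elim: n => [|n IH]; first by rewrite !big_geq.
rewrite big_nat_recr//= IH [in RHS]big_nat_recr//= subSn// subnn big_nat1.
rewrite [\sum_(0 <= i < n.+1) _]big_nat_recr//= subnn addrA; congr (_ + _).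
rewrite -big_split/= big_nat [RHS]big_nat; apply: eq_bigr => i /andP[_ iN].
by rewrite subSn ?(ltnW iN)// big_nat_recr.
Qed.

Lemma actsum_mul a b f n z : actsum (a * b) f n z =
  \sum_(0 <= i < n) transfern i (fun w => a i w * actsum b f (n - i) w) z.
Proof.
pose F i j := transfern i (fun w => a i w * transfern j (fun w => b j w * f w) w) z.
transitivity (\sum_(0 <= k < n) \sum_(0 <= i < k.+1) F i (k - i)%N); last first.
  rewrite sum_triangle; apply: eq_bigr => i _; rewrite /actsum.
  under [in RHS]eq_fun do rewrite mulr_sumr.
  by rewrite transfern_sum.
apply: eq_bigr => k _.
rewrite -[RHS]/((fun z => \sum_(0 <= i < k.+1)
  transfern i (fun w => a i w * transfern (k - i) (fun w => b (k - i)%N w * f w) w) z) z).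
transitivity (transfern k (fun w => \sum_(0 <= i < k.+1)
    a i (circle_exp w (2 ^ (k - i))) * (b (k - i)%N w * f w)) z).
  congr (transfern k _ z); apply/funext => w.
  rewrite fs_mulE mulr_suml big_mkord; apply: eq_bigr => i _.
  by rewrite mulrA.
rewrite transfern_sum big_nat [RHS]big_nat; apply: eq_bigr => i /andP[_].
rewrite ltnS => ik; rewrite -{1}(subnKC ik) transfernD.
congr (transfern i _ z); exact: transfernMl.
Qed.

Lemma actsum_bounded a f (D : R) : dominated a -> (forall z, normc (f z) <= D) ->
  exists K : R, forall n z, normc (actsum a f n z) <= K.
Proof.
move=> [M [C [aM MC]]] fD; exists (C * D) => n z.
apply: le_trans (normc_sum _ _) _.
apply: (@le_trans _ _ (\sum_(0 <= m < n) M m * D)).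
  apply: ler_sum => m _; apply: transfern_le => w _.
  by rewrite normcM ler_pM ?normc_ge0.
by rewrite -mulr_suml ler_wpM2r// (le_trans _ (fD (cis 0)))// normc_ge0.
Qed.

(** The action is associative: by [actsum_mul], the partial sums for [a * b] are
    convolutions of the summable sequence of the [a_i] with the partial sums for
    [b], which converge to [g]. *)
Lemma acts_mul a b f g h (Df : R) : dominated a -> dominated b ->
  (forall z, normc (f z) <= Df) ->
  acts b f g -> acts a g h -> acts (a * b) f h.
Proof.
move=> [M [C [aM MC]]] db fD bg ah.
have M0 m : 0 <= M m by apply: le_trans (aM m (cis 0)); exact: normc_ge0.
have C0 : 0 <= C by have := MC 0%N; rewrite big_geq.
have C1 : 0 < C + 1 by rewrite ltr_wpDl.
(* the distance of the partial sums of [b f] to [g] is bounded by [D] *)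
have [D D0 HD] : exists2 D : R, 0 <= D & forall n z, normc (actsum b f n z - g z) <= D.
  have [K HK] := actsum_bounded db fD; have [n0 H0] := bg _ ltr01.
  exists (K + (1 + K)) => [|n z].
    have := HK 0%N (cis 0); have := normc_ge0 (actsum b f 0 (cis 0)); lra.
  apply: le_trans (le_normcD _ _) _; rewrite lerD// normcN.
  have -> : g z = - (actsum b f n0 z - g z) + actsum b f n0 z by ring.
  by apply: le_trans (le_normcD _ _) _; rewrite normcN lerD// H0.
move=> e e0.
have [n1 H1] : exists n1, forall n, (n1 <= n)%N -> forall z,
    normc (actsum (a * b) f n z - actsum a g n z) <= e / 2.
  pose e1 := e / (4 * (C + 1)).
  have e10 : 0 < e1 by rewrite divr_gt0// mulr_gt0.
  have e20 : 0 < e / (4 * (D + 1)) by rewrite divr_gt0// mulr_gt0// ltr_wpDl.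
  have [n2 H2] := bg _ e10; have [n3 H3] := sum_tail M0 MC e20.
  exists (n2 + n3)%N => n n23 z.
  rewrite actsum_mul /actsum -sumrB.
  have Hi i : normc (transfern i (fun w => a i w * actsum b f (n - i) w) z -
      transfern i (fun w => a i w * g w) z) <= M i * (if (i < n3)%N then e1 else D).
    have -> : transfern i (fun w => a i w * actsum b f (n - i) w) z -
      transfern i (fun w => a i w * g w) z =
      transfern i (fun w => a i w * (actsum b f (n - i) w - g w)) z.
      under [in RHS]eq_fun do rewrite mulrBr -mulN1r.
      by rewrite transfern_add transfern_scale mulN1r.
    apply: transfern_le => w _; rewrite normcM ler_pM ?normc_ge0//.
    case: ifP => // in3; apply: H2.
    apply: leq_trans (leq_sub2l n (ltnW in3)).
    by rewrite -(addnK n3 n2) leq_sub2r.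
  apply: le_trans (normc_sum _ _) _.
  apply: le_trans (ler_sum _ (fun i _ => Hi i)) _.
  have n3n : (n3 <= n)%N by apply: leq_trans n23; exact: leq_addl.
  rewrite (@big_cat_nat _ _ _ n3)//= (splitr (e / 2)) lerD//.
    apply: (@le_trans _ _ (C * e1)).
      rewrite big_nat (eq_bigr (fun i => M i * e1)); last by move=> i /andP[_ ->].
      by rewrite -big_nat -mulr_suml ler_wpM2r// ltW.
    rewrite /e1 mulrA ler_pdivrMr ?mulr_gt0//.
    by move: C0 e0; nra.
  apply: (@le_trans _ _ (e / (4 * (D + 1)) * D)).
    rewrite big_nat (eq_bigr (fun i => M i * D)); last first.
      by move=> i /andP[n3i _]; rewrite ltnNge n3i.
    by rewrite -big_nat -mulr_suml ler_wpM2r.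
  rewrite mulrAC ler_pdivrMr ?mulr_gt0 ?ltr_wpDl//.
  by move: D0 e0; nra.
have e20 : 0 < e / 2 by rewrite divr_gt0.
have [n2 H2] := ah _ e20.
exists (maxn n1 n2) => n; rewrite geq_max => /andP[/H1 h1 /H2 h2] z.
have -> : actsum (a * b) f n z - h z =
  (actsum (a * b) f n z - actsum a g n z) + (actsum a g n z - h z) by ring.
by apply: le_trans (le_normcD _ _) _; rewrite (splitr e) lerD.
Qed.

Lemma acts_exists a f (D : R) : dominated a -> (forall z, normc (f z) <= D) ->
  exists g, acts a f g.
Proof.
move=> [M [C [aM MC]]] fD.
have M0 m : 0 <= M m by apply: le_trans (aM m (cis 0)); exact: normc_ge0.
have D0 : 0 <= D by apply: le_trans (fD (cis 0)); exact: normc_ge0.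
have D1 : 0 < D + 1 by rewrite ltr_wpDl.
apply: ucvg_cauchy => e e0.
have [n0 H0] := sum_tail M0 MC (divr_gt0 e0 D1).
exists n0 => n n0n z.
rewrite /actsum (@big_cat_nat _ _ _ n0 0 n)//= addrAC subrr add0r.
apply: le_trans (normc_sum _ _) _.
apply: (@le_trans _ _ (\sum_(n0 <= m < n) M m * D)).
  apply: ler_sum => m _; apply: transfern_le => w _.
  by rewrite normcM ler_pM ?normc_ge0.
rewrite -mulr_suml; apply: (@le_trans _ _ (e / (D + 1) * D)).
  by rewrite ler_wpM2r.
by rewrite mulrAC ler_pdivrMr// ler_pM2l// lerDl.
Qed.

End Action.

(** * The function module, its faithfulness and its irreducibility *)

Section PointMass.
Variable R : realType.
Implicit Types (z w : circle R).

(** Powers of [(1 + w/z)/2]; they tend pointwise to the indicator of [z]. *)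
Definition peak z (N : nat) : circle R -> R[i] :=
  fun w => (2^-1 * (1 + (circle_val z)^-1 * circle_val w)) ^+ N.

Lemma normc_half1D (v : R[i]) : normc v = 1 -> v <> 1 -> normc (2^-1 * (1 + v)) < 1.
Proof.
case: v => a b ab1 v1; rewrite /normc in ab1.
have {}ab1 : a ^+ 2 + b ^+ 2 = 1.
  by rewrite -[LHS]sqr_sqrtr ?addr_ge0 ?sqr_ge0// ab1 expr1n.
have a1 : a < 1.
  rewrite lt_neqAle; apply/andP; split.
    apply: contra_notN v1 => /eqP a1; move: ab1; rewrite a1 expr1n.
    by rewrite -[RHS]addr0 => /addrI/eqP; rewrite sqrf_eq0 => /eqP ->.
  by have := sqr_ge0 b; have := ab1; nra.
rewrite normcM normc_half ltr_pdivrMl// mulr1 /normc /=.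
have -> : 2 = Num.sqrt (2 ^+ 2) :> R by rewrite sqrtr_sqr ger0_norm.
by rewrite ltr_sqrt//; move: ab1; nra.
Qed.

Lemma peak_cvg z w : (peak z N w : R[i]^o) @[N --> \oo] --> ((w == z)%:R : R[i]^o).
Proof.
have [->|wz] := eqVneq w z.
  have -> : (fun N => peak z N z) = (fun=> 1).
    apply/funext => N; rewrite /peak mulVf ?circle_val_neq0//.
    by rewrite -(mulr2n 1) mulVf ?expr1n// pnatr_eq0.
  exact: cvg_cst.
have q1 : normc (2^-1 * (1 + (circle_val z)^-1 * circle_val w)) < 1.
  apply: normc_half1D; first by rewrite normcM normcV !normc_circle invr1 mulr1.
  move=> /(congr1 (fun x => circle_val z * x)).
  rewrite mulVKf ?circle_val_neq0// mulr1 => /circle_val_inj wz'.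
  by rewrite wz' eqxx in wz.
move=> B /nbhs_ccP[d d0 dB].
have : (normc (2^-1 * (1 + (circle_val z)^-1 * circle_val w)) ^+ N : R) @[N --> \oo] --> (0 : R).
  by apply: cvg_expr; rewrite ger0_norm ?normc_ge0.
move=> /cvgrPdist_lt/(_ d d0)[N0 _ H]; exists N0 => // N N0N; apply: dB.
have := H N N0N; rewrite /= !sub0r normrN normcN /peak normcX.
by rewrite ger0_norm// exprn_ge0// normc_ge0.
Qed.

Lemma cvg_sum_nat (u : nat -> nat -> R[i]) (l : nat -> R[i]) n :
  (forall m, (u m N : R[i]^o) @[N --> \oo] --> (l m : R[i]^o)) ->
  ((\sum_(0 <= m < n) u m N : R[i]^o) @[N --> \oo] -->
    (\sum_(0 <= m < n) l m : R[i]^o)).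
Proof.
move=> ul; elim: n => [|n IH].
  rewrite big_geq//; have -> : (fun N => \sum_(0 <= m < 0) u m N) = (fun=> 0).
    by apply/funext => N; rewrite big_geq.
  exact: cvg_cst.
have -> : \sum_(0 <= m < n.+1) l m = \sum_(0 <= m < n) l m + l n.
  by rewrite big_nat_recr.
have -> : (fun N => \sum_(0 <= m < n.+1) u m N) =
    (fun N => \sum_(0 <= m < n) u m N + u n N).
  by apply/funext => N; rewrite big_nat_recr.
exact: (@cvgD _ R[i]^o _ \oo _ _ _ _ _ IH (ul n)).
Qed.

Lemma cvg_normc_le (u : nat -> R[i]) (l : R[i]) (e : R) :
  ((u n : R[i]^o) @[n --> \oo] --> (l : R[i]^o)) -> (forall n, normc (u n) <= e) ->
  normc l <= e.
Proof.
move=> ul ue; apply/ler_addgt0Pr => d d0.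
have : nbhs (l : R[i]^o) [set y | normc (l - y) < d] by apply/nbhs_ccP; exists d.
move=> /ul[n _ /(_ n (leqnn n)) /= H].
by rewrite -[l](subrK (u n)); rewrite addrC (le_trans (le_normcD _ _))// lerD// ltW.
Qed.

End PointMass.

(** An algebra [A] of formal series, embedded by [ser], acts on the functions that
    satisfy [P]: the coefficients act by multiplication and [x] as the transfer
    operator. The hypothesis [P_key] is what makes this module irreducible. *)
Section FunctionModule.
Variables (R : realType) (A : pzRingType) (ser : A -> fseries R).
Local Notation X := (circle R -> R[i]).
Variable (P : X -> Prop).
Implicit Types (a b : A) (f g p h : X).

Hypothesis ser_inj : injective ser.
Hypothesis serD : forall a b, ser (a + b) = ser a + ser b.
Hypothesis serM : forall a b, ser (a * b) = ser a * ser b.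
Hypothesis ser1 : ser 1 = 1.
Hypothesis ser_dominated : forall a, dominated (ser a).
Hypothesis ser_ccont : forall a m, ccont (ser a m).
Hypothesis P_ccont : forall f, P f -> ccont f.
Hypothesis P1 : P (fun=> 1).
Hypothesis P_val : P (fun z => circle_val z).
Hypothesis PD : forall f g, P f -> P g -> P (fun z => f z + g z).
Hypothesis PM : forall f g, P f -> P g -> P (fun z => f z * g z).
Hypothesis PZ : forall c f, P f -> P (fun z => c * f z).
Hypothesis P_acts : forall a f g, P f -> acts (ser a) f g -> P g.
Hypothesis P_monomial : forall m p, P p -> exists a, ser a = fs_monomial m p.
Hypothesis P_key : forall f, P f -> f <> (fun=> 0) -> exists (n : nat) p h,
  [/\ P p, P h & forall z, h z * transfern n (fun w => p w * f w) z = 1].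

(** The set of functions satisfying [P]. *)
Definition pfun_pred : {pred X} := fun f => `[< P f >].

Lemma pfun_pred_zmod_closed : GRing.zmod_closed pfun_pred.
Proof.
split.
  apply/asboolP; have := PZ 0 P1; congr P.
  by apply/funext => z; rewrite mul0r.
move=> f g /asboolP Pf /asboolP Pg; apply/asboolP.
have := PD Pf (PZ (-1) Pg); congr P.
by apply/funext => z; rewrite mulN1r.
Qed.

HB.instance Definition _ := GRing.isZmodClosed.Build X pfun_pred pfun_pred_zmod_closed.

(** The module: the space of functions satisfying [P]. *)
Record pfun := PFun { pfun_val :> X; _ : pfun_val \in pfun_pred }.

HB.instance Definition _ := [isSub for pfun_val].
HB.instance Definition _ := [Choice of pfun by <:].
HB.instance Definition _ := [SubChoice_isSubZmodule of pfun by <:].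

Lemma pfunP (v : pfun) : P v.
Proof. by case: v => f /= /asboolP. Qed.

Lemma P_bounded f : P f -> exists D : R, forall z, normc (f z) <= D.
Proof. by move=> /P_ccont /circle_bounded[D _ fD]; exists D. Qed.

Lemma pscale_exists a (v : pfun) : exists u : pfun, acts (ser a) v u.
Proof.
have [D vD] := P_bounded (pfunP v).
have [g ag] := acts_exists (ser_dominated a) vD.
by exists (PFun (asboolT (P_acts (pfunP v) ag))).
Qed.

(** The action of the algebra on the module. *)
Definition pscale a (v : pfun) : pfun := projT1 (cid (pscale_exists a v)).

Lemma pscaleP a (v : pfun) : acts (ser a) v (pscale a v).
Proof. by rewrite /pscale; case: cid. Qed.

Lemma pscaleE a (v u : pfun) : acts (ser a) v u -> pscale a v = u.
Proof. by move=> au; apply: val_inj; exact: (ucvg_unique (pscaleP a v) au). Qed.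

Lemma pscaleA a b v : pscale a (pscale b v) = pscale (a * b) v.
Proof.
apply/esym/pscaleE; rewrite serM; have [D vD] := P_bounded (pfunP v).
exact: (acts_mul (ser_dominated a) (ser_dominated b) vD (pscaleP _ _) (pscaleP _ _)).
Qed.

Lemma pscale1 : left_id 1 pscale.
Proof. by move=> v; apply: pscaleE; rewrite ser1; exact: acts_one. Qed.

Lemma pscaleDr : right_distributive pscale +%R.
Proof. by move=> a u v; apply: pscaleE; exact: (acts_addr (pscaleP a u) (pscaleP a v)). Qed.

Lemma pscaleDl v : {morph pscale^~ v : a b / a + b}.
Proof.
by move=> a b; apply: pscaleE; rewrite serD; exact: (acts_addl (pscaleP a v) (pscaleP b v)).
Qed.

HB.instance Definition _ :=
  GRing.Zmodule_isLmodule.Build A pfun pscaleA pscale1 pscaleDr pscaleDl.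

Lemma pscale_monomial m p (v : pfun) : P p ->
  exists a : A, a *: v = transfern m (fun z => p z * v z) :> X.
Proof.
move=> /(P_monomial m)[a am]; exists a.
by apply: (ucvg_unique (pscaleP a v)); rewrite am; exact: acts_monomial.
Qed.

(** If [a] annihilates the peaks at a point [z] whose iterates under squaring are
    distinct, then at the limit [\sum_m 2^-m a_m(z) 1_(z^(2^m)) = 0], so that all
    the [a_m(z)] vanish; such points are dense. *)
Lemma pfun_faithful : faithful_module pfun.
Proof.
move=> a a0; apply: ser_inj.
have ser0 : ser 0 = 0 by apply: (addrI (ser 0)); rewrite -serD !addr0.
rewrite ser0; apply/funext => m0; apply/funext => z1; apply: contrapT => az1.
have az0 : 0 < normc (ser a m0 z1).
  rewrite lt_neqAle normc_ge0 andbT eq_sym; apply: contra_notN az1 => /eqP.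
  exact: eq0_normc.
have [d d0 ad] := (circle_continuousP _).1 (@ser_ccont a m0) z1 _ az0.
have [z0 /ad az01 z0_inj] := circle_nonperiodic_near z1 d0.
have az : ser a m0 z0 <> 0 by move=> az; rewrite az subr0 ltxx in az01.
(* the limit of the action of [a] on the peaks at [z0], evaluated at
   [w = z0^(2^m0)], only retains the term of degree [m0] *)
apply: az.
have Ppeak N : P (peak z0 N).
  elim: N => [|N IH]; first exact: P1.
  have -> : peak z0 N.+1 = fun w =>
      (2^-1 * (1 + (circle_val z0)^-1 * circle_val w)) * peak z0 N w.
    by apply/funext => w; rewrite /peak exprS.
  by apply: PM => //; apply: PZ; apply: PD => //; exact: PZ.
have act0 N : acts (ser a) (peak z0 N) (fun=> 0).
  have E : pscale a (PFun (asboolT (Ppeak N))) = 0 := a0 _.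
  by have := pscaleP a (PFun (asboolT (Ppeak N))); rewrite E.
pose w := circle_exp z0 (2 ^ m0).
have [M [C [aM MC]]] := ser_dominated a.
have M0 m : 0 <= M m by apply: le_trans (aM m (cis 0)); exact: normc_ge0.
have peak_le N u : normc (peak z0 N u) <= 1.
  rewrite /peak normcX exprn_ile1 ?normc_ge0//.
  apply: normc_avg; rewrite ?normc1// normcM normcV !normc_circle invr1 mulr1//.
have H : normc (2^-1 ^+ m0 * ser a m0 z0) = 0.
  apply/eqP; rewrite eq_le normc_ge0 andbT; apply/ler_addgt0Pr => e e0.
  have e20 : 0 < e / 2 by rewrite divr_gt0.
  rewrite add0r; have [n0 H0] := sum_tail M0 MC e20.
  pose n := maxn n0 m0.+1.
  apply: (@cvg_normc_le _ (fun N => actsum (ser a) (peak z0 N) n w)); last first.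
    move=> N; have [n1 /(_ (maxn n n1) (leq_maxr _ _) w)] := act0 N _ e20.
    rewrite subr0 /actsum (@big_cat_nat _ _ _ n 0 (maxn n n1))//= ?leq_maxl//.
    set S := \sum_(0 <= m < n) _; set T := \sum_(n <= m < _) _ => ST.
    have Te : normc T <= e / 2.
      apply: le_trans (normc_sum _ _) _.
      apply: (@le_trans _ _ (\sum_(n <= m < maxn n n1) M m)).
        apply: ler_sum => m _; apply: transfern_le => u _.
        rewrite normcM -[M m]mulr1 ler_pM ?normc_ge0//.
      apply: le_trans (H0 (maxn n n1)).
      rewrite [leRHS](@big_cat_nat _ _ _ n)//= ?leq_maxl//.
      by rewrite lerDr sumr_ge0.
    have -> : S = (S + T) - T by rewrite addrK.
    by apply: le_trans (le_normcD _ _) _; rewrite normcN (splitr e) lerD.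
  have -> : 2^-1 ^+ m0 * ser a m0 z0 =
      \sum_(0 <= m < n) transfern m (fun u => ser a m u * (u == z0)%:R) w.
    have E m : transfern m (fun u => ser a m u * (u == z0)%:R) w =
        2^-1 ^+ m * ser a m z0 * (m == m0)%:R.
      have -> : (fun u => ser a m u * (u == z0)%:R) = (fun u => ser a m z0 * (u == z0)%:R).
        by apply/funext => u; case: eqP => [->//|_]; rewrite !mulr0.
      by rewrite transfern_point /w -(inj_eq z0_inj) eq_sym.
    rewrite (bigD1_seq m0) ?iota_uniq//= ?mem_index_iota ?leq_maxr//.
    rewrite E eqxx mulr1 big1 ?addr0// => m mm0.
    by rewrite E (negbTE mm0) mulr0.
  rewrite /actsum; apply: cvg_sum_nat => m.
  apply: transfern_cvg => u.
  exact: (@cvgZ _ R[i]^o _ \oo _ (fun=> _) _ _ _ (cvg_cst _) (@peak_cvg _ z0 u)).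
move/eq0_normc/eqP: H; rewrite mulf_eq0 expf_eq0 invr_eq0 pnatr_eq0 andbF /=.
by move/eqP.
Qed.

(** By [P_key], the submodule generated by a nonzero function contains the constant 1, which
    generates the module. *)
Lemma pfun_irreducible : irreducible_module pfun.
Proof.
have one_in : (fun=> 1) \in pfun_pred by exact/asboolP.
split.
  exists 1, (PFun one_in); rewrite scale1r => /(congr1 (fun v : pfun => v (cis 0))) /=.
  by move/eqP; rewrite oner_eq0.
move=> U [U0 UZ].
have UZ' (a : A) (v : pfun) : v \in U -> a *: v \in U.
  by move=> vU; rewrite -[_ *: _]addr0; exact: UZ.
have [[v vU v0]|H] := pselect (exists2 v, v \in U & v <> 0); last first.
  left => v; rewrite inE; apply/idP/eqP => [vU|->//].
  by apply: contrapT => v0; apply: H; exists v.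
right => g; rewrite inE.
have v0' : (v : X) <> (fun=> 0) by move=> v0'; apply: v0; exact: val_inj.
have [n [p [h [Pp Ph hE]]]] := P_key (pfunP v) v0'.
have [a aE] := pscale_monomial n v Pp.
have [b bE] := pscale_monomial 0 (a *: v) Ph.
have [c cE] := pscale_monomial 0 (b *: (a *: v)) (pfunP g).
have -> : g = c *: (b *: (a *: v)).
  apply: val_inj; rewrite /= cE /=; apply/funext => z /=.
  by rewrite bE /= aE hE mulr1.
exact: (UZ' c _ (UZ' b _ (UZ' a v vU))).
Qed.

Lemma left_primitive_pfun : left_primitive A.
Proof. by exists pfun; split; [exact: pfun_irreducible|exact: pfun_faithful]. Qed.

End FunctionModule.

(** * Continuous functions *)

Section Summable.
Variable R : realType.
Local Notation X := (circle R -> R[i]).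
Implicit Types (z w u : circle R) (f g p : X).

Lemma nneseries_fin_bound (N : nat -> \bar R) : (forall m, (0 <= N m)%E) ->
  (\sum_(0 <= m <oo) N m < +oo)%E -> exists (M : nat -> R) (C : R),
  (forall m, N m = (M m)%:E) /\ (forall n, \sum_(0 <= m < n) M m <= C).
Proof.
move=> N0 Noo; have Nfin m : N m = (fine (N m))%:E.
  rewrite fineK// ge0_fin_numE//; apply: le_lt_trans Noo.
  apply: le_trans (nneseries_ge m.+1 N0); rewrite big_ord_recr/=.
  by rewrite leeDr// sume_ge0.
exists (fun m => fine (N m)), (fine (\sum_(0 <= m <oo) N m)); split => // n.
rewrite -lee_fin fineK ?ge0_fin_numE ?nneseries_ge0//.
apply: le_trans (nneseries_ge n N0); rewrite -sumEFin big_mkord.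
by under eq_bigr do rewrite -Nfin.
Qed.

Lemma dominated_series (a : fseries R) (N : nat -> \bar R) :
  (forall m, (0 <= N m)%E) -> (forall m z, ((normc (a m z))%:E <= N m)%E) ->
  (\sum_(0 <= m <oo) N m < +oo)%E -> dominated a.
Proof.
move=> N0 aN /(nneseries_fin_bound N0)[M [C [NM MC]]].
by exists M, C; split=> // m z; rewrite -lee_fin -NM.
Qed.

Lemma monomial_series_lt (N : X -> \bar R) m p : (forall f, (0 <= N f)%E) ->
  N (fun=> 0) = 0%E -> (N p < +oo)%E ->
  (\sum_(0 <= k <oo) N (fs_monomial m p k) < +oo)%E.
Proof.
move=> N0 N00; apply: le_lt_trans; apply: nneseries_le => // n.
have Nk k : N (fs_monomial m p k) = if k == m then N p else 0%E.
  have [->|km] := eqVneq k m.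
    by congr N; apply/funext => z; rewrite /fs_monomial eqxx.
  by rewrite -N00; congr N; apply/funext => z; rewrite /fs_monomial (negbTE km).
under eq_bigr do rewrite Nk.
have [mn|nm] := ltnP m n.
  rewrite (bigD1 (Ordinal mn))//= eqxx big1 ?adde0// => i im.
  by rewrite ifN//; apply: contraNneq im => im; apply/eqP/val_inj.
by rewrite big1// => i _; rewrite ifN// neq_ltn (leq_trans (ltn_ord i) nm).
Qed.

Lemma ccont_actsum (a : fseries R) f n :
  (forall m, ccont (a m)) -> ccont f -> ccont (actsum a f n).
Proof.
move=> ca cf; apply: ccont_sum => m; apply: ccont_transfern.
exact: (ccontM (ca m) cf).
Qed.

Lemma transfer_ge0 f z : (forall u, 0 <= f u) -> 0 <= transfer f z.
Proof. by move=> f0; rewrite /transfer mulr_ge0 ?invr_ge0 ?ler0n ?addr_ge0. Qed.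

Lemma transfern_gt0 m f u : (forall v, 0 <= f v) -> 0 < f u ->
  0 < transfern m f (circle_exp u (2 ^ m)).
Proof.
elim: m f u => [|m IH] f u f0 fu; first by rewrite circle_exp1.
rewrite transfernS expnS -circle_expM; apply: IH => [v|]; first exact: transfer_ge0.
by rewrite transfer_sqr mulr_gt0 ?invr_gt0 ?ltr0n ?ltr_pwDl.
Qed.

Lemma normc_conj (x : R[i]) : normc (Num.conj x) = normc x.
Proof. by have := norm_conjC x => /(congr1 (@complex.Re R)). Qed.

Lemma ccont_conj f : ccont f -> ccont (fun z => Num.conj (f z)).
Proof.
move=> /circle_continuousP cf; apply/circle_continuousP => z e e0.
have [d d0 fd] := cf z e e0; exists d => // w zw.
by rewrite -rmorphB normc_conj fd.
Qed.

Lemma ccontV f : ccont f -> (forall z, f z != 0) -> ccont (fun z => (f z)^-1).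
Proof.
move=> cf f0 z.
exact: (@cvgV _ _ (nbhs z) _ f (f z) (f0 z) (cf z)).
Qed.

(** For [n] large, the function [L^n |f|^2] is positive everywhere, as each point
    has a [2^n]-th root in an arc where [f] does not vanish; its inverse is the
    function [h]. *)
Lemma ccont_key f : ccont f -> f <> (fun=> 0) -> exists (n : nat) p h,
  [/\ ccont p, ccont h & forall z, h z * transfern n (fun w => p w * f w) z = 1].
Proof.
move=> cf f0.
have [z1 fz1] : exists z, f z <> 0.
  apply: contrapT => H; apply: f0; apply/funext => z.
  by apply: contrapT => fz; apply: H; exists z.
have fz1' : 0 < normc (f z1).
  rewrite lt_neqAle normc_ge0 andbT eq_sym; apply: contra_notN fz1 => /eqP.
  exact: eq0_normc.
have [d d0 fd] := (circle_continuousP _).1 cf z1 _ fz1'.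
have [n nP] := circle_root_near z1 d0.
pose g w := Num.conj (f w) * f w.
have cg : ccont g := ccontM (ccont_conj cf) cf.
have Lg z : transfern n g z != 0.
  have [u <- /fd fu] := nP z.
  rewrite gt_eqF//; apply: transfern_gt0 => [v|]; rewrite /g mulrC ?mul_conjC_ge0//.
  rewrite mul_conjC_gt0; apply: contraTneq fu => ->.
  by rewrite subr0 ltxx.
exists n, (fun w => Num.conj (f w)), (fun z => (transfern n g z)^-1); split.
- exact: (ccont_conj cf).
- exact: (ccontV (ccont_transfern cg) Lg).
- by move=> z; rewrite mulVf.
Qed.

Lemma algB_left_primitive : left_primitive (algB R).
Proof.
have BP (a : algB R) : (forall m, ccont (algB_val a m)) /\ (normB a < +oo)%E.
  by case: a => a /= /asboolP.
apply: (@left_primitive_pfun R (algB R) (@algB_val R) (fun f => ccont f)).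
- exact: val_inj.
- by [].
- by [].
- by [].
- move=> a; apply: (@dominated_series _ (fun m => normu (algB_val a m))).
  + by move=> m; exact: normu_ge0.
  + by move=> m z; exact: normu_ub.
  + exact: (BP a).2.
- by move=> a m; exact: (BP a).1.
- by [].
- exact: ccont_cst.
- exact: ccont_val.
- exact: ccontD.
- exact: ccontM.
- exact: ccontZ.
- move=> a f g cf; apply: ucvg_ccont => n.
  exact: (ccont_actsum (BP a).1 cf).
- move=> m p cp.
  have mB : fs_monomial m p \in @in_B R.
    apply/asboolP; split.
      move=> k; rewrite /fs_monomial; case: (k == m); first exact: cp.
      exact: ccont_cst.
    apply: monomial_series_lt; first exact: normu_ge0.
      apply/eqP; rewrite eq_le normu_ge0 andbT; apply: normu_le => z.
      by rewrite normc0.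
    have [K K0 pK] := circle_bounded cp.
    apply: (@le_lt_trans _ _ K%:E); last exact: ltry.
    by apply: normu_le => z; rewrite lee_fin.
  by exists (AlgB mB).
- exact: ccont_key.
Qed.

End Summable.

(** * The Wiener algebra *)

Section WienerModule.
Variable R : realType.
Local Notation X := (circle R -> R[i]).
Implicit Types (z w u : circle R) (f g p : X) (q s : seq (int * R[i])).

Lemma normw_sup f z (r : R) : ccont f -> (normw f <= r%:E)%E -> normc (f z) <= r.
Proof.
move=> cf fr; apply/ler_addgt0Pr => e e0.
have [q qr qf] := fejer_approx cf fr e0.
rewrite -[f z](subrK (tpoly q z)) addrC; apply: le_trans (le_normcD _ _) _.
by rewrite lerD// (le_trans (tpoly_le q z)).
Qed.

(** The balls of the Wiener algebra are closed under uniform convergence. *)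
Lemma normw_ucvg (F : nat -> X) f (r : R) : (forall n, ccont (F n)) ->
  (forall n, (normw (F n) <= r%:E)%E) -> ucvg F f -> (normw f <= r%:E)%E.
Proof.
move=> cF Fr Ff; apply: normw_approx; first exact: (ucvg_ccont cF Ff).
move=> e e0; have e20 : 0 < e / 2 by rewrite divr_gt0.
have [n /(_ n (leqnn n)) H] := Ff _ e20.
have [q qr qf] := fejer_approx (cF n) (Fr n) e20.
exists q => // z.
have -> : f z - tpoly q z = - (F n z - f z) + (F n z - tpoly q z) by ring.
by apply: le_trans (le_normcD _ _) _; rewrite normcN (splitr e) lerD.
Qed.

(** On Fourier series the transfer operator keeps the even frequencies and halves
    them. *)
Lemma transfer_valz (j : int) : transfer (fun z : circle R => circle_val z ^ j) =
  if (2 %| j)%Z then (fun z => circle_val z ^ (j %/ 2)%Z) else (fun=> 0).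
Proof.
apply/funext => z; have [u <-] := circle_root_exists z (isT : (0 < 2)%N).
rewrite transfer_sqr /circle_opp mk_circleE.
have u0 := circle_val_neq0 u.
have E v : v != 0 -> v ^ j = (v ^+ 2) ^ (j %/ 2)%Z * v ^ (j %% 2)%Z :> R[i].
  by move=> v0; rewrite [in LHS](divz_eq j 2) expfzDr// exprnP exprz_exp [2%Z * _]mulrC.
rewrite !E ?oppr_eq0// sqrrN.
have [j0|j0] := boolP (2 %| j)%Z.
  rewrite circle_expE; set c := _ ^ (j %/ 2)%Z.
  have -> : (j %% 2)%Z = 0 by exact/dvdz_mod0P.
  rewrite !expr0z !mulr1 -mulr2n -[c *+ 2]mulr_natl mulKf// pnatr_eq0//.
have -> : (j %% 2)%Z = 1.
  have := modz_ge0 j (isT : (2 : int) != 0); have := ltz_pmod j (isT : (0 : int) < 2).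
  move: j0; rewrite (sameP dvdz_mod0P eqP); case: (j %% 2)%Z => [[|[|?]]|?] //.
by rewrite !expr1z mulrN subrr mulr0.
Qed.

Lemma transfern_valz n (j : int) : (`|j| < 2 ^ n)%N ->
  transfern n (fun z : circle R => circle_val z ^ j) = (fun=> (j == 0)%:R).
Proof.
elim: n j => [|n IH] j jn.
  have -> : j = 0 by apply/eqP; rewrite -absz_eq0 -leqn0.
  by apply/funext => z; rewrite /= expr0z.
rewrite transfernS transfer_valz; case: ifPn => j2.
  have jE := divzK j2; rewrite -jE in jn.
  rewrite IH; first by rewrite -[in RHS]jE mulf_eq0 orbF.
  by move: jn; rewrite abszM expnSr ltn_pmul2r.
rewrite transfern0; apply/funext => z; case: eqP => // j0.
by rewrite j0 dvdz0 in j2.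
Qed.

Lemma transfer_tpoly q : exists2 s, tweight s <= tweight q &
  transfer (tpoly q) = tpoly s.
Proof.
elim: q => [|[j c] q [s sq qs]].
  exists [::] => //; have -> : tpoly [::] = (fun=> 0 : R[i]).
    by apply/funext => z; rewrite /tpoly big_nil.
  exact: (@transfern0 R 1).
have qE : tpoly ((j, c) :: q) = fun z : circle R => c * circle_val z ^ j + tpoly q z.
  by apply/funext => z; rewrite /tpoly big_cons.
exists (if (2 %| j)%Z then ((j %/ 2)%Z, c) :: s else s).
  rewrite {2}/tweight big_cons -/(tweight q).
  case: ifP => _; first by rewrite /tweight big_cons lerD2l.
  by apply: le_trans sq _; rewrite lerDr normc_ge0.
rewrite qE transferD transferZ qs transfer_valz; apply/funext => z.
case: ifP => _; first by rewrite /tpoly big_cons.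
by rewrite mulr0 add0r.
Qed.

Lemma normw_transfer f : ccont f -> (normw f < +oo)%E ->
  (normw (transfer f) <= normw f)%E.
Proof.
move=> cf /normw_fin[r r0 fr].
rewrite fr; apply: normw_approx; first exact: (ccont_transfer cf).
move=> e e0; have fr' : (normw f <= r%:E)%E by rewrite fr.
have [q qr qf] := fejer_approx cf fr' e0.
have [s sq sE] := transfer_tpoly q.
exists s; first exact: le_trans qr.
move=> z; rewrite -sE.
have -> : transfer f z - transfer (tpoly q) z = transfer (fun w => f w - tpoly q w) z.
  by rewrite /transfer; ring.
by apply: transfer_le => u _.
Qed.

Lemma wienerD f g : wiener f -> wiener g -> wiener (fun z => f z + g z).
Proof.
move=> [cf fo] [cg go]; split; first exact: (ccontD cf cg).
by apply: le_lt_trans (normwD cf cg fo go) _; exact: lte_add_pinfty.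
Qed.

Lemma wienerM f g : wiener f -> wiener g -> wiener (fun z => f z * g z).
Proof.
move=> [cf fo] [cg go]; split; first exact: (ccontM cf cg).
apply: le_lt_trans (normwM cf cg fo go) _; apply: lte_mul_pinfty => //.
  exact: normw_ge0.
by rewrite ge0_fin_numE// normw_ge0.
Qed.

Lemma normw_tpoly q : (normw (tpoly q) <= (tweight q)%:E)%E.
Proof.
apply: normw_approx; first exact: ccont_tpoly.
by move=> e e0; exists q => // z; rewrite subrr normc0 ltW.
Qed.

Lemma wiener_tpoly q : wiener (tpoly q).
Proof.
split; first exact: ccont_tpoly.
by apply: le_lt_trans (normw_tpoly q) _; exact: ltry.
Qed.

Lemma tpoly_term (j : int) c : (fun z : circle R => c * circle_val z ^ j) = tpoly [:: (j, c)].
Proof. by apply/funext => z; rewrite /tpoly big_seq1. Qed.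

Lemma tpoly_cst (c : R[i]) : (fun _ : circle R => c) = tpoly [:: (0, c)].
Proof. by rewrite -tpoly_term; apply/funext => z; rewrite expr0z mulr1. Qed.

Lemma wiener_cst c : wiener (fun _ : circle R => c).
Proof. by rewrite tpoly_cst; exact: wiener_tpoly. Qed.

Lemma wienerZ c f : wiener f -> wiener (fun z => c * f z).
Proof. by move=> wf; apply: (wienerM (wiener_cst c) wf). Qed.

Lemma wiener_transfer f : wiener f -> wiener (transfer f).
Proof.
move=> [cf fo]; split; first exact: (ccont_transfer cf).
exact: le_lt_trans (normw_transfer cf fo) fo.
Qed.

Lemma wiener_transfern m f : wiener f ->
  wiener (transfern m f) /\ (normw (transfern m f) <= normw f)%E.
Proof.
elim: m f => [|m IH] f wf; first by split; [exact: wf|exact: lexx].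
rewrite transfernS; have [wm fm] := IH _ (wiener_transfer wf); split; first exact: wm.
apply: le_trans fm _; exact: (normw_transfer wf.1 wf.2).
Qed.

Lemma normw_cst0 : normw (fun _ : circle R => 0%R) = 0%E.
Proof.
apply/eqP; rewrite eq_le normw_ge0 andbT.
have -> : (fun _ : circle R => 0 : R[i]) = tpoly [::].
  by apply/funext => z; rewrite /tpoly big_nil.
by apply: le_trans (normw_tpoly _) _; rewrite /tweight big_nil.
Qed.

Lemma normw_sum (F : nat -> X) (M : nat -> R) n :
  (forall m, wiener (F m)) -> (forall m, (normw (F m) <= (M m)%:E)%E) ->
  wiener (fun z => \sum_(0 <= m < n) F m z) /\
  (normw (fun z => \sum_(0 <= m < n) F m z)%R <= (\sum_(0 <= m < n) M m)%:E)%E.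
Proof.
move=> wF FM; elim: n => [|n [IH1 IH2]].
  have -> : (fun z => \sum_(0 <= m < 0) F m z) = fun=> 0.
    by apply/funext => z; rewrite big_geq.
  by split; [exact: wiener_cst|rewrite normw_cst0 big_geq].
have -> : (fun z => \sum_(0 <= m < n.+1) F m z) =
    fun z => (fun z => \sum_(0 <= m < n) F m z) z + F n z.
  by apply/funext => z; rewrite big_nat_recr.
split; first exact: (wienerD IH1 (wF n)).
apply: le_trans (normwD IH1.1 (wF n).1 IH1.2 (wF n).2) _.
have -> : \sum_(0 <= m < n.+1) M m = \sum_(0 <= m < n) M m + M n.
  by rewrite big_nat_recr.
by rewrite EFinD; apply: leeD.
Qed.

Lemma wiener_acts (a : fseries R) f g : (forall m, wiener (a m)) ->
  (normA a < +oo)%E -> wiener f -> acts a f g -> wiener g.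
Proof.
move=> wa na wf ag.
have cs n := ccont_actsum (n := n) (fun m => (wa m).1) wf.1.
split; first exact: (ucvg_ccont cs ag).
have [M [C [aM MC]]] := nneseries_fin_bound (fun m => normw_ge0 (a m)) na.
have [r r0 fr] := normw_fin wf.2.
apply: (@le_lt_trans _ _ (C * r)%:E); last exact: ltry.
apply: (normw_ucvg cs _ ag) => n.
have wF m := wienerM (wa m) wf.
have FM m : (normw (transfern m (fun w => (a m w * f w)%R)) <= (M m * r)%:E)%E.
  apply: le_trans (wiener_transfern m (wF m)).2 _.
  by apply: le_trans (normwM (wa m).1 wf.1 (wa m).2 wf.2) _; rewrite aM fr -EFinM.
have [_ H] := normw_sum n (fun m => (wiener_transfern m (wF m)).1) FM.
apply: le_trans H _.
by rewrite lee_fin -mulr_suml ler_wpM2r.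
Qed.

(** If [f] has norm less than 1 in the Wiener algebra, then [1 - f] is invertible
    there, by the Neumann series. *)
Lemma wiener_neumann f (q : R) : wiener f -> (normw f <= q%:E)%E -> q < 1 ->
  wiener (fun z => (1 - f z)^-1) /\ forall z, 1 - f z != 0.
Proof.
move=> wf fq q1.
have fz z : normc (f z) <= q by apply: normw_sup => //; exact: wf.1.
have q0 : 0 <= q by apply: le_trans (fz (cis 0)); exact: normc_ge0.
have q10 : 0 < 1 - q by rewrite subr_gt0.
have nz z : 1 - f z != 0.
  apply/eqP => /subr0_eq f1; have := fz z; rewrite -f1 normc1.
  by move=> /le_lt_trans/(_ q1); rewrite ltxx.
split; last exact: nz.
have nf1 z : 1 - q <= normc (1 - f z).
  have := le_normcD (1 - f z) (f z); rewrite subrK normc1.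
  by have := fz z; lra.
have wX i : wiener (fun z => f z ^+ i) /\ (normw (fun z => (f z ^+ i)%R) <= (q ^+ i)%:E)%E.
  elim: i => [|i [IH1 IH2]].
    split; first exact: wiener_cst.
    have -> : (fun z => f z ^+ 0) = tpoly [:: (0, 1)] by rewrite -tpoly_cst.
    apply: le_trans (normw_tpoly _) _.
    by rewrite /tweight big_seq1 normc1 expr0.
  have -> : (fun z => f z ^+ i.+1) = (fun z => f z * (fun z => f z ^+ i) z).
    by apply/funext => z; rewrite exprS.
  split; first exact: (wienerM wf IH1).
  apply: le_trans (normwM wf.1 IH1.1 wf.2 IH1.2) _.
  by rewrite exprS EFinM lee_pmul ?normw_ge0.
pose S n z := \sum_(0 <= i < n) f z ^+ i.
have HS n := normw_sum n (fun i => (wX i).1) (fun i => (wX i).2).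
have SE n z : S n z = (1 - f z ^+ n) * (1 - f z)^-1.
  apply: (mulIf (nz z)); rewrite mulfVK//.
  elim: n => [|n IH]; first by rewrite /S big_geq// mul0r subrr.
  by rewrite /S big_nat_recr//= mulrDl -/(S n z) IH exprS; ring.
have qS n : \sum_(0 <= i < n) q ^+ i <= (1 - q)^-1.
  rewrite -[leRHS]mul1r ler_pdivlMr//.
  have -> : (\sum_(0 <= i < n) q ^+ i) * (1 - q) = 1 - q ^+ n.
    elim: n => [|n IH]; first by rewrite big_geq// mul0r subrr.
    by rewrite big_nat_recr//= mulrDl IH exprS; ring.
  by rewrite gerBl exprn_ge0.
have uS : ucvg S (fun z => (1 - f z)^-1).
  move=> e e0.
  have : (q ^+ n : R) @[n --> \oo] --> (0 : R) by apply: cvg_expr; rewrite ger0_norm.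
  move=> /cvgrPdist_le/(_ (e * (1 - q)) (mulr_gt0 e0 q10))[n0 _ H0].
  exists n0 => n /H0; rewrite /= sub0r normrN ger0_norm ?exprn_ge0// => qn z.
  rewrite SE mulrBl mul1r addrAC subrr add0r normcN normcM normcV.
  rewrite ler_pdivrMr; last exact: lt_le_trans (nf1 z).
  rewrite normcX; apply: le_trans (_ : q ^+ n <= _).
    by rewrite lerXn2r ?nnegrE ?normc_ge0.
  by apply: le_trans qn _; rewrite ler_pM2l.
split; first exact: (ucvg_ccont (fun n => (HS n).1.1) uS).
apply: (@le_lt_trans _ _ (1 - q)^-1%:E); last exact: ltry.
apply: (normw_ucvg (fun n => (HS n).1.1) _ uS) => n.
by apply: le_trans (HS n).2 _; rewrite lee_fin.
Qed.

Lemma fourier_inj f : wiener f -> f <> (fun=> 0) -> exists n, fourier f n <> 0.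
Proof.
move=> wf f0; apply: contrapT => H; apply: f0; apply/funext => z.
apply: normc_eps0 => e e0.
have f0 : (normw f <= 0%:E)%E.
  rewrite /normw esum1// => n _; suff -> : fourier f n = 0 by rewrite normc0.
  by apply: contrapT => fn; apply: H; exists n.
by apply: le_trans (normw_sup z wf.1 f0) _; exact: ltW.
Qed.

(** Approximation in the norm of the Wiener algebra by a partial sum of the
    Fourier series; [0] is put among the frequencies for the use in
    [wiener_key]. *)
Lemma wiener_truncate f (e : R) : wiener f -> 0 < e -> exists s : seq int,
  [/\ uniq s, 0 \in s &
  (normw (fun z => f z - tpoly [seq (n, fourier f n) | n <- s] z)%R <= e%:E)%E].
Proof.
move=> wf e0; have [r r0 fr] := normw_fin wf.2.
have [s0 us0 s0r] : exists2 s : seq int, uniq s & r - e <= \sum_(n <- s) normc (fourier f n).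
  apply: contrapT => H.
  have : (normw f <= (r - e)%:E)%E.
    apply: esum_seq_le => s us; rewrite sumEFin lee_fin leNgt; apply/negP => rs.
    by apply: H; exists s => //; exact: ltW.
  by rewrite fr lee_fin lerBrDr gerDl leNgt e0.
pose s := undup (0 :: s0).
have us : uniq s := undup_uniq _.
have sr : r - e <= \sum_(n <- s) normc (fourier f n).
  apply: le_trans s0r _; rewrite /s /=; case: ifP => s00.
    by rewrite undup_id.
  by rewrite undup_id// big_cons lerDr normc_ge0.
exists s; split=> //; first by rewrite mem_undup mem_head.
set q := [seq _ | n <- s].
have qE n : fourier (tpoly q) n = if n \in s then fourier f n else 0.
  rewrite fourier_tpoly /q big_map /=; case: ifPn => ns.
    rewrite (bigD1_seq n)//= eqxx mulr1 big1 ?addr0// => i /negbTE ->.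
    by rewrite mulr0.
  rewrite big_seq big1// => i si; case: eqP => [ii|_]; last by rewrite mulr0.
  by rewrite -ii si in ns.
apply: esum_seq_le => t ut; rewrite sumEFin lee_fin.
have -> : \sum_(n <- t) normc (fourier (fun z => f z - tpoly q z) n) =
    \sum_(n <- t | n \notin s) normc (fourier f n).
  rewrite [RHS]big_mkcond; apply: eq_bigr => n _.
  rewrite (fourierB n wf.1 (@ccont_tpoly _ q)) qE; case: ifP => _.
    by rewrite subrr normc0.
  by rewrite subr0.
have : \sum_(n <- s ++ [seq n <- t | n \notin s]) normc (fourier f n) <= r.
  rewrite -lee_fin -sumEFin -fr; apply: esum_seq_ge.
  rewrite cat_uniq us filter_uniq// andbT /=.
  by apply/hasPn => n; rewrite mem_filter => /andP[].
by rewrite big_cat big_filter/=; lra.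
Qed.

(** If [c] is a nonzero Fourier coefficient of [f], of index [k], then
    [L^n (z^-k f)] tends to [c] in the norm of the Wiener algebra, since its
    coefficients are those of [f] at the frequencies [2^n j + k]; it is thus
    invertible for [n] large. *)
Lemma wiener_key f : wiener f -> f <> (fun=> 0) -> exists (n : nat) p h,
  [/\ wiener p, wiener h & forall z, h z * transfern n (fun w => p w * f w) z = 1].
Proof.
move=> wf /(fourier_inj wf)[k fk].
pose p z := circle_val z ^ (- k).
have wp : wiener p.
  have -> : p = tpoly [:: (- k, 1)].
    by rewrite -tpoly_term; apply/funext => z; rewrite mul1r.
  exact: wiener_tpoly.
pose g z := p z * f z.
have wg : wiener g := wienerM wp wf.
have g0 : fourier g 0 = fourier f k.
  by rewrite /fourier; congr circle_mean; apply/funext => z; rewrite oppr0 expr0z mulr1 mulrC.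
set c := fourier f k in fk g0.
have c0 : 0 < normc c.
  by rewrite lt_neqAle normc_ge0 andbT eq_sym; apply: contra_notN fk => /eqP/eq0_normc.
have cn0 : c != 0 by apply/eqP.
have [s [us s0 gs]] := wiener_truncate wg (divr_gt0 c0 (ltr0Sn _ 1)).
set q := [seq _ | n <- s] in gs.
(* [2^n] exceeds every frequency of [q] *)
pose n := (\sum_(j <- s) absz j)%N.
have Lq : transfern n (tpoly q) = fun=> c.
  rewrite /tpoly transfern_sum; apply/funext => z.
  rewrite big_map (bigD1_seq 0)//= transfern_scale transfern_valz ?expn_gt0//.
  rewrite eqxx mulr1 g0 big_seq_cond big1 ?addr0// => j /andP[js j0].
  rewrite transfern_scale transfern_valz ?(negbTE j0) ?mulr0//.
  apply: leq_ltn_trans (ltn_expl n (isT : (1 < 2)%N)).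
  by rewrite /n (bigD1_seq j)//= leq_addr.
pose d z := g z - tpoly q z.
have wd : wiener d.
  have := wienerD wg (wienerZ (-1) (wiener_tpoly q)); congr wiener.
  by apply/funext => z; rewrite mulN1r.
have Lg z : transfern n g z = c + transfern n d z.
  have -> : g = fun w => tpoly q w + d w by apply/funext => w; rewrite /d addrC subrK.
  by rewrite transfern_add Lq.
have [wLd Ldd] := wiener_transfern n wd.
pose r z := - c^-1 * transfern n d z.
have wr : wiener r := wienerZ (- c^-1) wLd.
have r2 : (normw r <= (2^-1)%:E)%E.
  apply: le_trans (normwZ _ wLd.1 wLd.2) _.
  have -> : 2^-1 = normc (- c^-1) * (normc c / 2) :> R.
    by rewrite normcN normcV mulrA mulVf ?mul1r// gt_eqF.
  rewrite EFinM.
  by apply: (lee_pmul _ (normw_ge0 _) _ (le_trans Ldd gs)); rewrite lee_fin ?normc_ge0.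
have [|wi inz] := wiener_neumann wr r2; first by rewrite invf_lt1 ?ltr1n.
exists n, p, (fun z => c^-1 * (1 - r z)^-1); split.
- exact: wp.
- exact: (wienerZ c^-1 wi).
- move=> z; rewrite -[X in transfern n X]/g Lg.
  have -> : c + transfern n d z = c * (1 - r z).
    by rewrite /r mulNr opprK mulrDr mulr1 mulVKf.
  by rewrite mulrACA mulVf// mulVf// mulr1.
Qed.

Lemma algA_left_primitive : left_primitive (algA R).
Proof.
have AP (a : algA R) : (forall m, wiener (algA_val a m)) /\ (normA a < +oo)%E.
  by case: a => a /= /asboolP.
apply: (@left_primitive_pfun R (algA R) (@algA_val R) (@wiener R)).
- exact: val_inj.
- by [].
- by [].
- by [].
- move=> a; apply: (@dominated_series _ _ (fun m => normw (algA_val a m))).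
  + by move=> m; exact: normw_ge0.
  + move=> m z; have [r r0 ar] := normw_fin ((AP a).1 m).2.
    by rewrite ar lee_fin; apply: (normw_sup z ((AP a).1 m).1); rewrite ar.
  + exact: (AP a).2.
- by move=> a m; exact: ((AP a).1 m).1.
- by move=> f [].
- exact: wiener_cst.
- have -> : (fun z : circle R => circle_val z) = tpoly [:: (1, 1)].
    by rewrite -tpoly_term; apply/funext => z; rewrite mul1r expr1z.
  exact: wiener_tpoly.
- exact: wienerD.
- exact: wienerM.
- exact: wienerZ.
- by move=> a f g; apply: wiener_acts; [exact: (AP a).1|exact: (AP a).2].
- move=> m p wp.
  have mA : fs_monomial m p \in @in_A R.
    apply/asboolP; split.
      move=> k; rewrite /fs_monomial; case: (k == m); first exact: wp.
      exact: wiener_cst.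
    apply: (monomial_series_lt _ (@normw_ge0 R) normw_cst0); exact: wp.2.
  by exists (AlgA mA).
- exact: wiener_key.
Qed.

End WienerModule.

Theorem theorem2p1 (R : realType) :
  left_primitive (algA R) /\ left_primitive (algB R).
Proof. by split; [exact: algA_left_primitive|exact: algB_left_primitive]. Qed.
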